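(* Let $A$ be a unital commutative $\mathbb{R}$-algebra equipped with a submultiplicative seminorm $\rho$, let $B$ be a linear subspace of $A$, let $d\in\mathbb{N}$, let $S\subseteq A$ be a $\sum A^{2d}$-module, and let $L:B\to\mathbb{R}$ be a linear functional. Then there exists a positive Radon measure $\mu$ on $\mathcal{X}(A)$, whose support is contained in $\mathfrak{sp}_{\rho}(A)\cap\mathcal{K}_{S}$, such that $L(b)=\int \hat{b}\,d\mu$ for all $b\in B$, if and only if there exists $D>0$ such that $$L(b)\le D\,\|b\|_{S;\rho}\quad\text{for all } b\in B.$$
   Context: All algebras are unital commutative $\mathbb{R}$-algebras. A submultiplicative seminorm on $A$ is a map $\rho:A\to[0,\infty)$ with $\rho(ra)=|r|\rho(a)$, $\rho(a+b)\le\rho(a)+\rho(b)$, $\rho(ab)\le\rho(a)\rho(b)$ for all $a,b\in A$, $r\in\mathbb{R}$. $\mathcal{X}(A)$ is the set of all $\mathbb{R}$-algebra homomorphisms $A\to\mathbb{R}$ (the character space), assumed nonempty throughout. For $a\in A$, $\hat a:\mathcal{X}(A)\to\mathbb{R}$ is $\hat a(\alpha)=\alpha(a)$; $\mathcal{X}(A)$ carries the weakest topology making all $\hat a$ continuous, and its Borel $\sigma$-algebra. For a Borel set $K\subseteq\mathcal{X}(A)$, a Radon measure $\mu$ has support contained in $K$ if $\mu(M)=0$ for every Borel $M\subseteq\mathcal{X}(A)$ with $M\cap K=\emptyset$. $\mathfrak{sp}_\rho(A)$ (the Gelfand spectrum) is the set of $\rho$-continuous elements of $\mathcal{X}(A)$,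 equivalently $\{\alpha\in\mathcal{X}(A): |\alpha(a)|\le\rho(a)\ \forall a\in A\}$. A cone in $A$ is a (nonempty) subset closed under sums and under multiplication by nonnegative reals. $\sum A^{2d}$ is the cone of finite sums of $2d$-th powers of elements of $A$. A $\sum A^{2d}$-module is a cone $S\subseteq A$ containing $1$ with $a^{2d}\cdot S\subseteq S$ for all $a\in A$. For $S\subseteq A$, $\mathcal{K}_S:=\{\alpha\in\mathcal{X}(A):\alpha(s)\ge0\ \forall s\in S\}$. For a cone $C\subseteq A$ and $a\in A$, $\|a\|_{C;\rho}:=\inf_{p\in C}\rho(a+p)$. *)

(* Defs.v *)
From HB Require Import structures.
From mathcomp Require Import all_boot all_order all_algebra.
From mathcomp Require Import all_classical all_reals all_analysis.

Set Implicit Arguments.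
Unset Strict Implicit.
Unset Printing Implicit Defensive.

Import Order.TTheory GRing.Theory Num.Theory.
Import numFieldNormedType.Exports.

Local Open Scope classical_set_scope.
Local Open Scope ring_scope.

Record submultiplicative_seminorm (R : realType) (A : comAlgType R)
    (rho : A -> R) : Prop := SubmultiplicativeSeminorm {
  ssn_ge0 : forall a, 0 <= rho a ;
  ssnZ : forall (r : R) a, rho (r *: a) = `|r| * rho a ;
  ssnD : forall a b, rho (a + b) <= rho a + rho b ;
  ssnM : forall a b, rho (a * b) <= rho a * rho b }.

Definition character (R : realType) (A : comAlgType R) : Type :=
  {lrmorphism A -> R^o}.

Definition gelfand (R : realType) (A : comAlgType R) (a : A)
    (alpha : character A) : R := (alpha : {lrmorphism A -> R^o}) a.

HB.instance Definition _ (R : realType) (A : comAlgType R) :=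
  gen_eqMixin (character A).
HB.instance Definition _ (R : realType) (A : comAlgType R) :=
  gen_choiceMixin (character A).

(* The weakest topology making every [gelfand a] continuous, as the supremum of
   the initial topologies of these functions. *)
HB.instance Definition _ (R : realType) (A : comAlgType R) :=
  Topological.copy (character A)
    (@sup_topology (character A) A
       (fun a => Topological.class (initial_topology (@gelfand R A a)))).

(* The library's measurable types are pointed. [charspace ne] is [character A]
   with a point extracted from [ne], which serves no other purpose. *)
Definition charspace (R : realType) (A : comAlgType R)
    (ne : [set: character A] !=set0) : Type := character A.

HB.instance Definition _ (R : realType) (A : comAlgType R)
    (ne : [set: character A] !=set0) := Topological.on (charspace ne).
HB.instance Definition _ (R : realType) (A : comAlgType R)
    (ne : [set: character A] !=set0) :=
  isPointed.Build (charspace ne) (projT1 (cid ne)).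

Notation borel_charspace ne := (g_sigma_algebraType (@open (charspace ne))).

(* Locally finite and inner regular with respect to compact sets; the topology
   is Hausdorff, so compact sets are Borel. *)
Definition radon (R : realType) (A : comAlgType R)
    (ne : [set: character A] !=set0)
    (mu : {measure set (borel_charspace ne) -> \bar R}) : Prop :=
  (forall alpha : character A,
     exists U : set (character A), [/\ open U, U alpha & (mu U < +oo)%E]) /\
  (forall M : set (borel_charspace ne), measurable M ->
     mu M = ereal_sup
       [set mu K | K in [set K : set (character A) | compact K /\ K `<=` M]]).

Definition support_contained (R : realType) (A : comAlgType R)
    (ne : [set: character A] !=set0)
    (mu : {measure set (borel_charspace ne) -> \bar R})
    (K : set (character A)) : Prop :=
  forall M : set (borel_charspace ne), measurable M -> M `&` K = set0 ->
    mu M = 0%E.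

Definition seminorm_continuous (R : realType) (A : comAlgType R)
    (rho : A -> R) (f : A -> R) : Prop :=
  forall a (e : R), 0 < e -> exists2 delta : R, 0 < delta &
    forall b, rho (b - a) < delta -> `|f b - f a| < e.

Definition gelfand_spectrum (R : realType) (A : comAlgType R)
    (rho : A -> R) : set (character A) :=
  [set alpha | seminorm_continuous rho (fun a => gelfand a alpha)].

Definition cone (R : realType) (A : comAlgType R) (C : set A) : Prop :=
  [/\ C !=set0,
      forall a b, C a -> C b -> C (a + b) &
      forall (r : R) a, 0 <= r -> C a -> C (r *: a)].

Definition power_module (R : realType) (A : comAlgType R) (d : nat)
    (S : set A) : Prop :=
  [/\ cone S, S 1 & forall a s, S s -> S (a ^+ (2 * d) * s)].

Definition nonneg_characters (R : realType) (A : comAlgType R)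
    (S : set A) : set (character A) :=
  [set alpha | forall s, S s -> 0 <= gelfand s alpha].

Definition cone_seminorm (R : realType) (A : comAlgType R) (C : set A)
    (rho : A -> R) (a : A) : R :=
  inf [set rho (a + p) | p in C].

(* Main.v *)
From HB Require Import structures.
Require Import Defs.
From mathcomp Require Import all_boot all_order all_algebra.
From mathcomp Require Import ring lra.
From mathcomp Require Import all_classical all_reals all_analysis.
From mathcomp Require Import measurable_realfun.

Set Implicit Arguments.
Unset Strict Implicit.
Unset Printing Implicit Defensive.

Import Order.TTheory GRing.Theory Num.Theory.
Import numFieldNormedType.Exports.

Local Open Scope classical_set_scope.
Local Open Scope ring_scope.

(** Let [K] be the set of characters that are [rho]-continuous and nonnegative
    on [S]. A continuous character satisfies [`|x a| <= rho a], so [K] is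
    compact.

    If [mu] represents [L], then [mu K] is finite and, for [s] in [S] and [x]
    in [K], [x b <= x (b + s) <= rho (b + s)]; integrating over [K] and taking
    the infimum over [s] gives the estimate ([representing_measure_bound]).

    For the converse, let [T] be the [rho]-closure of [S]. Elements close to [1]
    are limits of [2 * d]-th powers ([approx_root]), so they multiply [T] into
    itself; that is, the multipliers of [T] form an archimedean semiring. Among
    the cones that are stable under these multipliers and do not contain [- 1],
    a maximal one is total, and comparison with scalars modulo such a cone is a
    character ([semiordering_character]). It follows that an element of [A] that
    is positive on [K] lies in [T] ([positivstellensatz],
    [ssn_closure_positive]). Applied to [c - b], where [b < c] on [K] and
    [0 < c], this bounds [cone_seminorm S rho b] by [c * rho 1]; hence [L b] is
    at most [D * rho 1] times the supremum over [K] of the positive part of [b].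

    That bound is sublinear in the function [b] on [K], so the Hahn-Banach
    theorem extends [L] to a functional [F] on all functions that are bounded on
    [K], and the domination makes [F] positive. As [F] is defined on indicator
    functions, it yields a finitely additive set function directly, without
    approximating continuous functions by elements of [A]. The inner
    regularization of this set function on open sets generates an outer measure
    for which open sets are measurable ([regular_measure_exists]), and a
    layer-cake argument shows that the resulting Radon measure integrates
    continuous functions to their [F]-value ([riesz_representation]). *)

(** * Submultiplicative seminorms and approximate roots *)

Section Seminorm.
Variables (R : realType) (A : comAlgType R) (rho : A -> R).
Hypothesis rho_seminorm : submultiplicative_seminorm rho.

Lemma ssn0 : rho 0 = 0.
Proof. by rewrite -(scale0r 0) (ssnZ rho_seminorm) normr0 mul0r. Qed.

Lemma ssnN a : rho (- a) = rho a.
Proof. by rewrite -scaleN1r (ssnZ rho_seminorm) normrN1 mul1r. Qed.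

Lemma ssnX a n : rho (a ^+ n.+1) <= rho a ^+ n.+1.
Proof.
elim: n => [|n IH]; first by rewrite !expr1.
rewrite exprS [leRHS]exprS (le_trans (ssnM rho_seminorm _ _))//.
by rewrite ler_wpM2l// (ssn_ge0 rho_seminorm).
Qed.

Lemma ssnM_small (x z : A) (e : R) : e <= 1 -> rho x <= e -> rho (x * z) <= rho z.
Proof.
move=> e1 xe; apply: (le_trans (ssnM rho_seminorm _ _)).
by rewrite ler_piMl ?(ssn_ge0 rho_seminorm)// (le_trans xe).
Qed.

Lemma ssn_expr1D n : exists2 c : R, 0 <= c & forall (e : R) y,
  e <= 1 -> rho y <= e -> rho ((1 + y) ^+ n - 1) <= c * e.
Proof.
elim: n => [|n [c c0 IH]].
  by exists 0 => // e y _ _; rewrite expr0 subrr ssn0 mul0r.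
exists (c *+ 2 + 1); first by rewrite addr_ge0// mulrn_wge0.
move=> e y e1 ye.
have -> : (1 + y) ^+ n.+1 - 1 =
    ((1 + y) ^+ n - 1) + y * ((1 + y) ^+ n - 1) + y by rewrite exprS; ring.
rewrite mulrDl mul1r mulrnAl mulr2n.
apply: (le_trans (ssnD rho_seminorm _ _)); rewrite lerD//.
apply: (le_trans (ssnD rho_seminorm _ _)); rewrite lerD//; first exact: IH.
by apply: (le_trans (ssnM_small _ e1 ye)); exact: IH.
Qed.

(** Near [1] the map [u |-> u ^+ n] behaves like multiplication by [n]. *)
Lemma ssn_expr1D_sub n : exists2 c : R, 0 <= c & forall (e : R) x y,
  e <= 1 -> rho x <= e -> rho y <= e ->
  exists2 w, (1 + x) ^+ n - (1 + y) ^+ n = (x - y) * (n%:R + w) &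
             rho w <= c * e.
Proof.
elim: n => [|n [c c0 IH]].
  exists 0 => // e x y _ _ _; exists 0; last by rewrite ssn0 mul0r.
  by rewrite !expr0 subrr addr0 mulr0.
have [d d0 Hd] := ssn_expr1D n.
exists (c + c + n%:R + d); first by rewrite !addr_ge0.
move=> e x y e1 xe ye; have [w Ew wce] := IH e x y e1 xe ye.
exists (w + x * w + n%:R * x + ((1 + y) ^+ n - 1)).
  rewrite [(1 + x) ^+ _]exprS [(1 + y) ^+ n.+1]exprS.
  have -> : (1 + x) ^+ n = (1 + y) ^+ n + (x - y) * (n%:R + w).
    by rewrite -Ew; ring.
  by rewrite -natr1; ring.
rewrite !mulrDl; apply: (le_trans (ssnD rho_seminorm _ _)).
rewrite lerD ?Hd//; apply: (le_trans (ssnD rho_seminorm _ _)).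
rewrite lerD//; first apply: (le_trans (ssnD rho_seminorm _ _)).
  by rewrite lerD// (le_trans (ssnM_small _ e1 xe)).
by rewrite mulr_natl -scaler_nat (ssnZ rho_seminorm) ger0_norm// ler_wpM2l.
Qed.

(** Elements close to [1] are limits of [n]-th powers: the iteration
    [x |-> x - ((1 + x) ^+ n - 1 - a) / n] halves the error at each step. *)
Lemma approx_root n : (0 < n)%N -> exists2 delta : R, 0 < delta &
  forall a, rho a <= delta -> forall e : R, 0 < e ->
  exists b, rho (1 + a - b ^+ n) < e.
Proof.
move=> n0; have [c c0 Hc] := ssn_expr1D_sub n.
have n1 : 1 <= n%:R :> R by rewrite ler1n.
have nne : n%:R != 0 :> R by rewrite pnatr_eq0 -lt0n.
pose e0 : R := (1 + 2 * c)^-1.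
have c1 : 0 < 1 + 2 * c by rewrite ltr_pwDl// mulr_ge0.
have e00 : 0 < e0 by rewrite invr_gt0.
have e01 : e0 <= 1 by rewrite invf_le1// lerDl mulr_ge0.
have ce0 : c * e0 <= 2^-1.
  by rewrite ler_pdivrMr//; lra.
exists (e0 / 2); first by rewrite divr_gt0.
move=> a ae e e_gt0.
pose res x : A := (1 + x) ^+ n - 1 - a.
have step k : exists x, rho (res x) <= rho a * 2^-1 ^+ k /\
    rho x <= 2 * rho a * (1 - 2^-1 ^+ k).
  elim: k => [|k [x [rx xk]]].
    exists 0; split; last by rewrite ssn0 expr0 subrr mulr0.
    by rewrite expr0 mulr1 /res addr0 expr1n subrr sub0r ssnN.
  have ra0 := ssn_ge0 rho_seminorm a.
  have pk0 : 0 <= 2^-1 ^+ k :> R by rewrite exprn_ge0.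
  have nx : rho (x - n%:R^-1 *: res x) <= 2 * rho a * (1 - 2^-1 ^+ k.+1).
    apply: (le_trans (ssnD rho_seminorm _ _)).
    rewrite ssnN (ssnZ rho_seminorm) ger0_norm ?invr_ge0//.
    apply: (@le_trans _ _ (2 * rho a * (1 - 2^-1 ^+ k) + rho a * 2^-1 ^+ k)).
      rewrite lerD// (le_trans _ rx)// ler_piMl ?(ssn_ge0 rho_seminorm)//.
      by rewrite invf_le1// ltr0n.
    by rewrite exprS; nra.
  exists (x - n%:R^-1 *: res x); split=> //.
  have xe0 : rho x <= e0 by nra.
  have ye0 : rho (x - n%:R^-1 *: res x) <= e0.
    have : 0 <= 2^-1 ^+ k.+1 :> R by rewrite exprn_ge0.
    by nra.
  have [w Ew wce] := Hc _ _ _ e01 ye0 xe0.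
  have -> : res (x - n%:R^-1 *: res x) = - (n%:R^-1 *: (res x * w)).
    transitivity (res x + ((1 + (x - n%:R^-1 *: res x)) ^+ n - (1 + x) ^+ n)).
      by rewrite /res; ring.
    rewrite Ew [x - _ - x]addrAC subrr sub0r mulNr -scalerAl mulrDr scalerDr.
    by rewrite mulr_natr -[res x *+ n]scaler_nat scalerA mulVf// scale1r opprD addNKr.
  rewrite ssnN (ssnZ rho_seminorm) ger0_norm ?invr_ge0//.
  have h : rho (res x * w) <= rho a * 2^-1 ^+ k * 2^-1.
    apply: (le_trans (ssnM rho_seminorm _ _)).
    rewrite ler_pM ?(ssn_ge0 rho_seminorm)//.
    exact: le_trans wce ce0.
  rewrite exprS [2^-1 * _]mulrC mulrA (le_trans _ h)//.
  by rewrite ler_piMl ?(ssn_ge0 rho_seminorm)// invf_le1// ltr0n.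
have [k ke] : exists k, rho a * 2^-1 ^+ k < e.
  have ra1 : 0 < rho a + 1 by rewrite ltr_wpDl// (ssn_ge0 rho_seminorm).
  have [k] : exists k, (2^-1 : R) ^+ k < e / (rho a + 1).
    have h2 : (2 : R)^-1 < 1 by rewrite invf_lt1// ltr1n.
    have := @cvg_expr R 2^-1; rewrite ger0_norm// => /(_ h2).
    move/cvgr_lt => /(_ (e / (rho a + 1))); rewrite divr_gt0// => /(_ isT).
    by move=> [k _ /(_ k)]; rewrite /= leqnn => /(_ isT) ?; exists k.
  rewrite ltr_pdivlMr// => h; exists k; apply: le_lt_trans h.
  by rewrite mulrC ler_wpM2l ?exprn_ge0// lerDl.
have [x [rx _]] := step k; exists (1 + x).
by rewrite -ssnN; apply: le_lt_trans ke; rewrite (_ : - _ = res x)// /res; ring.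
Qed.

(** Closure of [S] for the topology of the seminorm [rho]. *)
Definition ssn_closure (S : set A) : set A :=
  [set t | forall e : R, 0 < e -> exists2 s, S s & rho (t - s) < e].

Lemma sub_ssn_closure S : S `<=` ssn_closure S.
Proof. by move=> s Ss e e0; exists s => //; rewrite subrr ssn0. Qed.

End Seminorm.

(** * Characters *)

Section Characters.
Variables (R : realType) (A : comAlgType R).

Section Build.
Variable f : A -> R^o.
Hypotheses (fD : forall a b, f (a + b) = f a + f b)
  (fZ : forall (r : R) a, f (r *: a) = r *: f a)
  (fM : forall a b, f (a * b) = f a * f b) (f1 : f 1 = 1).

Let fB : zmod_morphism f.
Proof. by move=> a b; rewrite fD -scaleN1r fZ scaleN1r. Qed.

HB.instance Definition _ := GRing.isZmodMorphism.Build A R^o f fB.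
HB.instance Definition _ := GRing.isMonoidMorphism.Build A R^o f (conj f1 fM).
HB.instance Definition _ := GRing.isScalable.Build R A R^o *:%R f fZ.

(** The character with underlying function [f]. *)
Definition character_of : character A := f : {lrmorphism A -> R^o}.

End Build.

Lemma character_exists (f : A -> R) :
  (forall a b, f (a + b) = f a + f b) -> (forall (r : R) a, f (r *: a) = r * f a) ->
  (forall a b, f (a * b) = f a * f b) -> f 1 = 1 ->
  exists alpha : character A, forall a, gelfand a alpha = f a.
Proof. by move=> fD fZ fM f1; exists (character_of fD fZ fM f1). Qed.

Lemma gelfandD a b (x : character A) : gelfand (a + b) x = gelfand a x + gelfand b x.
Proof. exact: (raddfD (x : {lrmorphism A -> R^o})). Qed.
Lemma gelfandB a b (x : character A) : gelfand (a - b) x = gelfand a x - gelfand b x.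
Proof. exact: (raddfB (x : {lrmorphism A -> R^o})). Qed.
Lemma gelfandM a b (x : character A) : gelfand (a * b) x = gelfand a x * gelfand b x.
Proof. exact: (rmorphM (x : {lrmorphism A -> R^o})). Qed.
Lemma gelfandX a n (x : character A) : gelfand (a ^+ n) x = gelfand a x ^+ n.
Proof. exact: (rmorphXn (x : {lrmorphism A -> R^o})). Qed.
Lemma gelfandZ r a (x : character A) : gelfand (r *: a) x = r * gelfand a x.
Proof. exact: (linearZ_LR (x : {lrmorphism A -> R^o})). Qed.
Lemma gelfand1 (x : character A) : gelfand 1 x = 1.
Proof. exact: (rmorph1 (x : {lrmorphism A -> R^o})). Qed.
Lemma gelfandN a (x : character A) : gelfand (- a) x = - gelfand a x.
Proof. exact: (raddfN (x : {lrmorphism A -> R^o})). Qed.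

End Characters.

(** * Cones, multipliers and the Positivstellensatz *)

Section Stabilizer.
Variables (R : realType) (A : comAlgType R).

Lemma cone0 (C : set A) : cone C -> C 0.
Proof. by move=> [[c Cc] _ CZ]; rewrite -(scale0r c); exact: CZ. Qed.

(** The multipliers of a cone; the sets that they preserve take the place
    of the modules over sums of powers. *)
Definition stabilizer (T : set A) : set A := [set p | forall t, T t -> T (p * t)].

Lemma stabilizer1 T : stabilizer T 1.
Proof. by move=> t; rewrite mul1r. Qed.
Lemma stabilizerM T p q : stabilizer T p -> stabilizer T q -> stabilizer T (p * q).
Proof. by move=> Tp Tq t Tt; rewrite -mulrA; exact/Tp/Tq. Qed.
Lemma stabilizerD T p q : cone T -> stabilizer T p -> stabilizer T q -> stabilizer T (p + q).
Proof. by move=> [_ TD _] Tp Tq t Tt; rewrite mulrDl; apply: TD; [exact: Tp|exact: Tq]. Qed.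
Lemma stabilizerZ T (r : R) p : cone T -> 0 <= r -> stabilizer T p -> stabilizer T (r *: p).
Proof. by move=> [_ _ TZ] r0 Tp t Tt; rewrite -scalerAl; apply: TZ => //; exact: Tp. Qed.
Lemma stabilizer_scalar T (r : R) : cone T -> 0 <= r -> stabilizer T r%:A.
Proof. by move=> cT r0; apply: stabilizerZ => //; exact: stabilizer1. Qed.

(** A cone stable under multiplication by the elements of [P]. *)
Definition stable_cone (P Q : set A) :=
  cone Q /\ forall p q, P p -> Q q -> Q (p * q).

Lemma maximal_stable_cone (P Q0 : set A) : stable_cone P Q0 -> ~ Q0 (- 1) ->
  exists Q, [/\ stable_cone P Q, Q0 `<=` Q, ~ Q (- 1) &
    forall Q', stable_cone P Q' -> Q `<=` Q' -> ~ Q' (- 1) -> Q' `<=` Q].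
Proof.
move=> mQ0 Q0N1.
pose G X := [/\ stable_cone P X, Q0 `<=` X & ~ X (- 1)].
(* the empty set is adjoined so that the union of the empty chain qualifies *)
have [F FG Ftot|X [[X0|[mX QX XN1]] maxX]] :=
    @Zorn_bigcup A [set X | X = set0 \/ G X].
- have [[X FX X0]|noX] := pselect (exists2 X, F X & X !=set0); last first.
    left; rewrite -subset0 => a [X FX Xa]; apply: noX.
    by exists X => //; exists a.
  have Fgood Y a : F Y -> Y a -> G Y.
    by move=> FY Ya; have [/= Y0|//] := FG _ FY; rewrite Y0 in Ya.
  have GX : G X by have [a Xa] := X0; exact: Fgood Xa.
  right; split.
  + split; first split.
    * by have [a Xa] := X0; exists a; exists X.
    * move=> a b [Y FY Ya] [Z FZ Zb]; have [YZ|ZY] := Ftot _ _ FY FZ.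
        have [[[_ ZD _] _] _ _] := Fgood _ _ FZ Zb.
        by exists Z => //; apply: ZD => //; exact: YZ.
      have [[[_ YD _] _] _ _] := Fgood _ _ FY Ya.
      by exists Y => //; apply: YD => //; exact: ZY.
    * move=> r a r0 [Y FY Ya]; exists Y => //.
      by have [[[_ _ YZ] _] _ _] := Fgood _ _ FY Ya; exact: YZ.
  + move=> p q Pp [Y FY Yq]; exists Y => //.
    by have [[_ YM] _ _] := Fgood _ _ FY Yq; exact: YM.
  + by move=> q Qq; exists X => //; have [_ QX _] := GX; exact: QX.
  + by move=> [Y FY YN1]; have [_ _ /(_ YN1)] := Fgood _ _ FY YN1.
- exfalso; apply: (maxX Q0); last by right; split.
  rewrite X0; split; first exact: sub0set.
  by move=> /(_ 0); apply; apply: cone0; case: mQ0.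
- exists X; split=> // Q' mQ' XQ' Q'N1 a Q'a.
  apply: contrapT => Xa; apply: (maxX Q').
    by split=> // /(_ a Q'a).
  by right; split=> //; exact: subset_trans QX XQ'.
Qed.

End Stabilizer.

Section Positivstellensatz.
Variables (R : realType) (A : comAlgType R) (T : set A).
Hypotheses (coneT : cone T) (T1 : T 1).
(** The multipliers of [T] are archimedean. *)
Hypothesis archT : forall a, exists2 r : R, 0 < r & stabilizer T (r%:A + a).

Let P := stabilizer T.

Let archB a : exists2 r : R, 0 < r & P (r%:A - a).
Proof. exact: archT. Qed.

Section Semiordering.
Variable Q : set A.
Hypotheses (stQ : stable_cone P Q) (Q1 : Q 1) (QN1 : ~ Q (- 1))
  (maxQ : forall Q', stable_cone P Q' -> Q `<=` Q' -> ~ Q' (- 1) -> Q' `<=` Q).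

Let QD a b : Q a -> Q b -> Q (a + b).
Proof. by case: stQ => -[_ QD _] _; exact: QD. Qed.
Let QZ (r : R) a : 0 <= r -> Q a -> Q (r *: a).
Proof. by case: stQ => -[_ _ QZ] _; exact: QZ. Qed.
Let QM p q : P p -> Q q -> Q (p * q).
Proof. by case: stQ => _; exact. Qed.
Let Q0 : Q 0.
Proof. by apply: cone0; case: stQ. Qed.
Let PQ p : P p -> Q p.
Proof. by move=> Pp; rewrite -(mulr1 p); exact: QM. Qed.
Let Qsc (r : R) : 0 <= r -> Q r%:A.
Proof. by move=> r0; exact: QZ. Qed.
Let Qsc_ge0 (r : R) : Q r%:A -> 0 <= r.
Proof.
move=> Qr; rewrite leNgt; apply/negP => r0; apply: QN1.
have -> : - 1 = (- r^-1) *: r%:A :> A.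
  by rewrite scalerA mulNr mulVf ?lt_eqF// scaleN1r.
by apply: QZ => //; rewrite oppr_ge0 invr_le0 ltW.
Qed.

Let adjoin x : ~ Q x -> exists q p (e : R),
  [/\ Q q, P p, 0 < e, Q (p - e%:A) & - 2^-1%:A = q + p * x].
Proof.
move=> Qx; pose Q' := [set a | exists q p, [/\ Q q, P p & a = q + p * x]].
have P1 : P 1 by exact: stabilizer1.
have Px0 : P 0 by rewrite -(scale0r 1); exact: stabilizerZ.
have stQ' : stable_cone P Q'.
  split; first split.
  - by exists 0, 0, 0; split=> //; rewrite mul0r addr0.
  - move=> _ _ [q [p [Qq Pp ->]]] [q' [p' [Qq' Pp' ->]]].
    exists (q + q'), (p + p'); split; [exact: QD|exact: stabilizerD|].
    by rewrite mulrDl addrACA.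
  - move=> r _ r0 [q [p [Qq Pp ->]]]; exists (r *: q), (r *: p); split.
    + exact: QZ.
    + exact: stabilizerZ.
    + by rewrite scalerDr scalerAl.
  - move=> p' _ Pp' [q [p [Qq Pp ->]]]; exists (p' * q), (p' * p); split.
    + exact: QM.
    + exact: stabilizerM.
    + by rewrite mulrDr mulrA.
have [q [p [Qq Pp Eqp]]] : Q' (- 1).
  apply: contrapT => Q'N1; apply: Qx; apply: (maxQ stQ') => //.
    by move=> a Qa; exists a, 0; split=> //; rewrite mul0r addr0.
  by exists 0, 1; split=> //; rewrite mul1r add0r.
(* adding a small constant to p bounds it below by a positive scalar *)
have [N N0 PN] := archB x.
pose e : R := 2^-1 / N.
have e0 : 0 < e by rewrite divr_gt0.
exists (q + e *: (N%:A - x)), (p + e%:A), e; split=> //.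
- by apply: QD => //; apply: QZ; [exact: ltW|exact: PQ].
- by apply: stabilizerD => //; apply: stabilizer_scalar => //; exact: ltW.
- by rewrite addrK; exact: PQ.
- rewrite scalerBr scalerA /e divfK ?gt_eqF// mulrDl -/e -scalerAl mul1r.
  have -> : q + (2^-1%:A - e *: x) + (p * x + e *: x) = (q + p * x) + 2^-1%:A.
    by ring.
  have half : 2^-1%:A + 2^-1%:A = 1 :> A.
    rewrite -scalerDl -[RHS](scale1r 1); congr (_ *: _).
    by rewrite -mulr2n -[_ *+ 2]mulr_natr mulVf ?pnatr_eq0.
  by rewrite -Eqp -{2}half; ring.
Qed.

(** Were neither [x] nor [- x] in [Q], then [- 2^-1] would be of the form
    [q + p * x] and of the form [q' - p' * x]; eliminating [x] puts a negative
    scalar in [Q]. *)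
Let Qtotal x : Q x \/ Q (- x).
Proof.
have [|Qx] := pselect (Q x); [by left|].
have [|QNx] := pselect (Q (- x)); [by right|exfalso].
have [q [p [e [Qq Pp e0 Qp E]]]] := adjoin Qx.
have [q' [p' [e' [Qq' Pp' e'0 Qp' E']]]] := adjoin QNx.
have : Q (- (2^-1 * (e + e'))%:A).
  have -> : - (2^-1 * (e + e'))%:A = (p' * q + p * q') +
      2^-1 *: ((p - e%:A) + (p' - e'%:A)).
    have -> : p' * q = - (2^-1 *: p') - p' * p * x.
      apply/eqP; rewrite -subr_eq opprK eq_sym -mulrA -mulrDr -E.
      by rewrite mulrN -scalerAr mulr1.
    have -> : p * q' = - (2^-1 *: p) + p' * p * x.
      apply/eqP; rewrite -subr_eq [p' * p]mulrC -mulrA -mulrN -mulrDr -[- (p' * x)]mulrN -E'.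
      by rewrite mulrN -scalerAr mulr1.
    by rewrite mulrDr scalerDl !scalerDr !scalerN !scalerA; ring.
  apply: QD; first by apply: QD; exact: QM.
  by apply: QZ => //; exact: QD.
rewrite -scaleNr => /Qsc_ge0; rewrite oppr_ge0 leNgt => /negP; apply.
by rewrite mulr_gt0// addr_gt0.
Qed.

(** [near x c] says that [x] and the scalar [c] agree for the semiordering [Q]
    up to infinitesimals. *)
Let near x (c : R) := forall e : R, 0 < e ->
  Q (x - c%:A + e%:A) /\ Q (c%:A - x + e%:A).

Let near_uniq x c c' : near x c -> near x c' -> c = c'.
Proof.
suff le c1 c2 : near x c1 -> near x c2 -> c1 <= c2.
  by move=> n1 n2; apply/eqP; rewrite eq_le !le.
move=> n1 n2; apply/ler_addgt0Pr => e e0.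
have e20 : 0 < e / 2 by rewrite divr_gt0.
rewrite -subr_ge0; apply: Qsc_ge0.
have -> : (c2 + e - c1)%:A = (x - c1%:A + (e / 2)%:A) + (c2%:A - x + (e / 2)%:A).
  rewrite [in LHS](splitr e) !(scalerDl, scaleNr) ; ring.
by apply: QD; [case: (n1 _ e20)|case: (n2 _ e20)].
Qed.

Let near_ex x : exists c, near x c.
Proof.
pose E := [set r : R | Q (x - r%:A)].
have [N N0 PN] := archT x; have [M M0 PM] := archB x.
have supE : has_sup E.
  split; first by exists (- N); rewrite /E/= scaleNr opprK addrC; exact: PQ.
  exists M => r Er; rewrite -subr_ge0; apply: Qsc_ge0.
  have -> : (M - r)%:A = (M%:A - x) + (x - r%:A) by rewrite scalerBl; ring.
  by apply: QD => //; exact: PQ.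
exists (sup E) => e e0; split.
  have [r Er re] := sup_adherent e0 supE.
  have -> : x - (sup E)%:A + e%:A = (x - r%:A) + (r - (sup E - e))%:A.
    by rewrite !(scalerBl, scalerDl); ring.
  by apply: QD => //; apply: Qsc; rewrite subr_ge0 ltW.
have [Qx|] := Qtotal (x - (sup E + e)%:A).
  have : sup E + e <= sup E by apply: sup_ubound => //; case: supE.
  by rewrite gerDl leNgt e0.
by rewrite opprB scalerDl addrAC.
Qed.

Let nearD x y c d : near x c -> near y d -> near (x + y) (c + d).
Proof.
move=> nx ny e e0; have e20 : 0 < e / 2 by rewrite divr_gt0.
have [? ?] := nx _ e20; have [? ?] := ny _ e20; split.
  have -> : x + y - (c + d)%:A + e%:A =
      (x - c%:A + (e / 2)%:A) + (y - d%:A + (e / 2)%:A).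
    by rewrite [in LHS](splitr e) !scalerDl; ring.
  exact: QD.
have -> : (c + d)%:A - (x + y) + e%:A =
    (c%:A - x + (e / 2)%:A) + (d%:A - y + (e / 2)%:A).
  by rewrite [in LHS](splitr e) !scalerDl; ring.
exact: QD.
Qed.

Let nearN x c : near x c -> near (- x) (- c).
Proof.
move=> nx e e0; have [h1 h2] := nx _ e0.
by rewrite scaleNr !opprK; split; [rewrite [- x + _]addrC|rewrite [- _ + x]addrC].
Qed.

Let nearP x c p : P p -> near x c -> near (p * (x - c%:A)) 0.
Proof.
move=> Pp nx e e0; have [N N0 PN] := archB p.
have eN0 : 0 < e / N by rewrite divr_gt0.
have rest : Q ((e / N) *: (N%:A - p)).
  by apply: QZ; [exact: ltW|exact: PQ].
have E : (e / N) *: (N%:A - p) = e%:A - p * (e / N)%:A.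
  by rewrite scalerBr scalerA divfK ?gt_eqF// -scalerAr mulr1.
have [h1 h2] := nx _ eN0; rewrite scale0r; split.
  have -> : p * (x - c%:A) - 0 + e%:A =
      p * (x - c%:A + (e / N)%:A) + (e / N) *: (N%:A - p) by rewrite E; ring.
  by apply: QD => //; exact: QM.
have -> : 0 - p * (x - c%:A) + e%:A =
    p * (c%:A - x + (e / N)%:A) + (e / N) *: (N%:A - p) by rewrite E; ring.
by apply: QD => //; exact: QM.
Qed.

Let near_scalar (r : R) : near r%:A r.
Proof. by move=> e e0; rewrite subrr add0r; split; apply: Qsc; exact: ltW. Qed.

Let nearM x y c d : near x c -> near y d -> near (x * y) (c * d).
Proof.
move=> nx ny.
have key z : near (z * (x - c%:A)) 0.
  have [r r0 Pr] := archT z.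
  have -> : z * (x - c%:A) =
      (r%:A + z) * (x - c%:A) + - (r%:A * (x - c%:A)) by ring.
  rewrite -[X in near _ X](addr0 0) -[X in near _ (_ + X)]oppr0.
  apply: nearD; first exact: nearP.
  by apply/nearN/nearP => //; apply: stabilizer_scalar => //; exact: ltW.
have key2 : near (c%:A * (y - d%:A)) 0.
  have [r r0 Pr] := archT c%:A.
  have -> : c%:A * (y - d%:A) =
      (r%:A + c%:A) * (y - d%:A) + - (r%:A * (y - d%:A)) by ring.
  rewrite -[X in near _ X](addr0 0) -[X in near _ (_ + X)]oppr0.
  apply: nearD; first exact: nearP.
  by apply/nearN/nearP => //; apply: stabilizer_scalar => //; exact: ltW.
have -> : x * y = (y * (x - c%:A) + c%:A * (y - d%:A)) + (c * d)%:A.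
  have -> : (c * d)%:A = c%:A * d%:A :> A by rewrite -scalerAl mul1r scalerA.
  by ring.
rewrite -[X in near _ X]add0r; apply: nearD; last exact: near_scalar.
by rewrite -[X in near _ X](addr0 0); exact: nearD.
Qed.

(** A maximal proper stable cone is nonnegative for some character. *)
Lemma semiordering_character : exists alpha : character A,
  forall a, Q a -> 0 <= gelfand a alpha.
Proof.
pose f a := xget 0 [set c | near a c].
have fP a : near a (f a).
  by have [c nc] := near_ex a; exact: (xgetPex 0 (ex_intro _ c nc)).
have f_eq a c : near a c -> f a = c by exact: near_uniq.
have fM a b : f (a * b) = f a * f b by apply: f_eq; exact: nearM.
have [alpha Ealpha] : exists alpha : character A, forall a, gelfand a alpha = f a.
  apply: character_exists => //.
  - by move=> a b; apply: f_eq; exact: nearD.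
  - move=> r a; rewrite -[in LHS](mul1r a) scalerAl fM; congr (_ * _).
    by apply: f_eq; exact: near_scalar.
  - by apply: f_eq; rewrite -{1}(scale1r 1); exact: near_scalar.
exists alpha => a Qa; rewrite Ealpha; apply/ler_addgt0Pr => e e0.
apply: Qsc_ge0; have [_ h] := fP a e e0.
by have := QD Qa h; rewrite scalerDl addrA addrCA subrr addr0.
Qed.

End Semiordering.

(** An element of [A] that is positive at every character nonnegative on [T]
    lies in [T]. *)
Lemma positivstellensatz f :
  (forall alpha : character A, nonneg_characters T alpha -> 0 < gelfand f alpha) ->
  T f.
Proof.
move=> fpos; have [_ TD TZ] := coneT.
have P1 : P 1 by exact: stabilizer1.
have Px0 : P 0 by rewrite -(scale0r 1); exact: stabilizerZ.
have PT p : P p -> T p by move=> Pp; rewrite -(mulr1 p); exact: Pp.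
have T0 : T 0 by exact: PT.
pose Q0 := [set a | exists t p, [/\ T t, P p & a = t - p * f]].
have stQ0 : stable_cone P Q0.
  split; first split.
  - by exists 0, 0, 0; split=> //; rewrite mul0r subr0.
  - move=> _ _ [q [p [Qq Pp ->]]] [q' [p' [Qq' Pp' ->]]].
    exists (q + q'), (p + p'); split; [exact: TD|exact: stabilizerD|].
    by ring.
  - move=> r _ r0 [q [p [Qq Pp ->]]]; exists (r *: q), (r *: p); split.
    + exact: TZ.
    + exact: stabilizerZ.
    + by rewrite scalerBr scalerAl.
  - move=> p' _ Pp' [q [p [Qq Pp ->]]]; exists (p' * q), (p' * p); split.
    + exact: Pp'.
    + exact: stabilizerM.
    + by ring.
have TQ0 t : T t -> Q0 t.
  by move=> Tt; exists t, 0; split=> //; rewrite mul0r subr0.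
have [t [p [Tt Pp Etp]]] : Q0 (- 1).
  apply: contrapT => Q0N1.
  have [Q [stQ Q0Q QN1 maxQ]] := maximal_stable_cone stQ0 Q0N1.
  have [alpha Qalpha] :=
    semiordering_character stQ (Q0Q _ (TQ0 _ T1)) QN1 maxQ.
  have : 0 < gelfand f alpha.
    by apply: fpos => t Tt; apply: Qalpha; exact/Q0Q/TQ0.
  rewrite ltNge -oppr_ge0 -gelfandN => /negP; apply; apply: Qalpha; apply: Q0Q.
  by exists 0, 1; split=> //; rewrite mul1r sub0r.
have [k k0 Pk] := archB p; have [N N0 PN] := archT f.
(* from p * f = 1 + t one gains 1 / k at each step *)
have step (r : R) : 0 <= r -> T (f + r%:A) -> T (f + (r - k^-1)%:A).
  move=> r0 Tr.
  have -> : f + (r - k^-1)%:A =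
      k^-1 *: ((k%:A - p) * (f + r%:A) + (r *: p + t)).
    have -> : t = p * f - 1 by rewrite -[- 1]opprK -[1]opprK Etp; ring.
    have -> : (k%:A - p) * (f + r%:A) + (r *: p + (p * f - 1)) =
        k%:A * (f + r%:A) - 1.
      by rewrite !(mulrDl, mulrDr) -!scalerAr -!scalerAl !(mulNr, scalerN, mul1r, mulr1); ring.
    by rewrite -scalerAl mul1r scalerBr scalerA mulVf ?gt_eqF// scale1r scalerBl addrA.
  apply: (TZ); first by rewrite invr_ge0 ltW.
  by apply: (TD); [exact: Pk|apply: (TD) => //; apply: (TZ) => //; exact: PT].
have down (r : R) : r <= 0 -> T (f + r%:A) -> T f.
  move=> r0 Tr; rewrite (_ : f = (f + r%:A) + (- r)%:A); last by rewrite scaleNr addrK.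
  by apply: TD => //; apply: TZ => //; rewrite oppr_ge0.
have iter n : T f \/ T (f + (N - n%:R * k^-1)%:A).
  elim: n => [|n [|IH]]; [|by left|].
    by right; rewrite mul0r subr0 addrC; exact: PT.
  have [h|h] := leP 0 (N - n%:R * k^-1).
    by right; have := step _ h IH; rewrite -natr1 mulrDl mul1r opprD addrA.
  by left; exact: down (ltW h) IH.
have [//|Tn] := iter (Num.trunc (N * k)).+1.
apply: down Tn; rewrite subr_le0.
by rewrite ler_pdivlMr// ltW// truncnS_gt.
Qed.

End Positivstellensatz.

(** * Hahn-Banach theorem *)

Section HahnBanach.
Variables (R : realType) (V : lmodType R) (W : set V) (p : V -> R).
Hypotheses (WD : forall u v, W u -> W v -> W (u + v))
  (WZ : forall (r : R) v, W v -> W (r *: v))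
  (pD : forall u v, W u -> W v -> p (u + v) <= p u + p v)
  (pZ : forall (r : R) v, 0 < r -> W v -> p (r *: v) = r * p v).

(** A linear functional on a subspace of [W] that is dominated by [p], given
    as a graph. *)
Definition dominated_graph (G : set (V * R^o)) :=
  [/\ G 0, forall x y, G x -> G y -> G (x + y),
      forall (r : R) x, G x -> G (r *: x) &
      forall x, G x -> W x.1 /\ (x.2 : R) <= p x.1].

(** One-step extension: any value between [sup E] and the corresponding
    infimum is admissible at [w]. *)
Let extend G w : dominated_graph G -> W w ->
  exists c : R, dominated_graph [set x | exists y (t : R), G y /\ x = y + t *: (w, c : R^o)].
Proof.
move=> [G0 GD GZ Gp] Ww.
pose E := [set (y.2 - p (y.1 - w) : R) | y in G].
have WB v : W v -> W (v - w) by move=> Wv; rewrite -scaleN1r; exact/WD/WZ.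
have Ele y z : G y -> G z -> (y.2 : R) - p (y.1 - w) <= p (z.1 + w) - z.2.
  move=> Gy Gz; rewrite lerBlDr addrAC lerBrDr.
  have [_ /le_trans] := Gp _ (GD _ _ Gy Gz); apply.
  have [[Wy _] [Wz _]] := (Gp _ Gy, Gp _ Gz).
  rewrite [leRHS]addrC -[leLHS]/(p (y.1 + z.1)).
  have -> : y.1 + z.1 = (y.1 - w) + (z.1 + w) by rewrite [z.1 + w]addrC addrA subrK.
  by apply: pD; [exact: WB|exact: WD].
have supE : has_sup E.
  split; first by exists ((0 : R^o) - p (0 - w)); exists 0.
  by exists (p (0 + w) - 0) => _ [y Gy <-]; exact: (Ele y 0).
have cge y : G y -> (y.2 : R) - p (y.1 - w) <= sup E.
  by move=> Gy; apply: sup_ubound; [case: supE|exists y].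
have cle z : G z -> sup E <= p (z.1 + w) - z.2.
  by move=> Gz; apply: ge_sup; [case: supE|move=> _ [y Gy <-]; exact: Ele].
exists (sup E); split.
- by exists 0, 0; rewrite scale0r addr0.
- move=> _ _ [y [t [Gy ->]]] [z [s [Gz ->]]]; exists (y + z), (t + s).
  by split; [exact: GD|rewrite scalerDl addrACA].
- move=> r _ [y [t [Gy ->]]]; exists (r *: y), (r * t).
  by split; [exact: GZ|rewrite scalerDr scalerA].
- move=> _ [y [t [Gy ->]]]; have [Wy yp] := Gp _ Gy; split.
    by apply: WD => //; exact: WZ.
  rewrite -[leLHS]/((y.2 : R) + t * sup E) -[leRHS]/(p (y.1 + t *: w)).
  have [t0|t0|->] := ltgtP t 0; last by rewrite mul0r scale0r !addr0.
  + have Nt : 0 < - t by rewrite oppr_gt0.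
    have := cge _ (GZ (- t)^-1 _ Gy); rewrite -(ler_pM2l Nt) mulrBr.
    rewrite -[((- t)^-1 *: y).2]/((- t)^-1 * y.2) -[((- t)^-1 *: y).1]/((- t)^-1 *: y.1).
    rewrite mulrA mulfV ?gt_eqF// mul1r -pZ//; last exact/WB/WZ.
    rewrite scalerBr scalerA mulfV ?gt_eqF// scale1r scaleNr opprK; lra.
  + have := cle _ (GZ t^-1 _ Gy); rewrite -(ler_pM2l t0) mulrBr.
    rewrite -[(t^-1 *: y).2]/(t^-1 * y.2) -[(t^-1 *: y).1]/(t^-1 *: y.1).
    rewrite [t * (t^-1 * _)]mulrA mulfV ?gt_eqF// mul1r -pZ//; last exact/WD/Ww/WZ.
    rewrite scalerDr scalerA mulfV ?gt_eqF// scale1r; lra.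
Qed.

(** Hahn-Banach theorem, relative to a subspace [W] on which [p] is
    sublinear. *)
Lemma hahn_banach (G0 : set (V * R^o)) : dominated_graph G0 ->
  exists F : V -> R,
    [/\ forall u v, W u -> W v -> F (u + v) = F u + F v,
        forall (r : R) v, W v -> F (r *: v) = r * F v,
        forall v, W v -> F v <= p v &
        forall x, G0 x -> F x.1 = x.2].
Proof.
move=> domG0.
pose good G := dominated_graph G /\ G0 `<=` G.
have [F FG Ftot|G [[G_0|[domG G0G]] maxG]] :=
    @Zorn_bigcup (V * R^o)%type [set G | G = set0 \/ good G].
- have [[X FX X0]|noX] := pselect (exists2 X, F X & X !=set0); last first.
    left; rewrite -subset0 => a [X FX Xa]; apply: noX.
    by exists X => //; exists a.
  have Fgood Y a : F Y -> Y a -> good Y.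
    by move=> FY Ya; have [/= Y0|//] := FG _ FY; rewrite Y0 in Ya.
  have gX : good X by have [a Xa] := X0; exact: Fgood Xa.
  right; split; first split.
  + by exists X => //; case: gX => -[].
  + move=> x y [Y FY Yx] [Z FZ Zy]; have [YZ|ZY] := Ftot _ _ FY FZ.
      have [[_ ZD _ _] _] := Fgood _ _ FZ Zy.
      by exists Z => //; apply: ZD => //; exact: YZ.
    have [[_ YD _ _] _] := Fgood _ _ FY Yx.
    by exists Y => //; apply: YD => //; exact: ZY.
  + move=> r x [Y FY Yx]; exists Y => //.
    by have [[_ _ YZ _] _] := Fgood _ _ FY Yx; exact: YZ.
  + by move=> x [Y FY Yx]; have [[_ _ _ Yp] _] := Fgood _ _ FY Yx; exact: Yp.
  + by move=> x G0x; exists X => //; case: gX => _; exact.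
- exfalso; apply: (maxG G0); last by right; split.
  rewrite G_0; split; first exact: sub0set.
  by move=> /(_ 0); apply; case: domG0.
have [G00 GD GZ Gp] := domG.
have Gdom v : W v -> exists r : R, G (v, r : R^o).
  move=> Wv; have [c domG'] := extend domG Wv; exists c.
  set G' := (X in dominated_graph X) in domG'.
  have GG' : G `<=` G' by move=> x Gx; exists x, 0; rewrite scale0r addr0.
  apply: contrapT => Gvc; apply: (maxG G'); last first.
    by right; split=> //; exact: subset_trans GG'.
  split=> // /(_ (v, c : R^o)) G'G; apply/Gvc/G'G.
  by exists 0, 1; rewrite scale1r add0r.
have p0 : W 0 -> p 0 = 0.
  move=> W0; have := @pZ 2 0 _ W0; rewrite scaler0 => /(_ _)/eqP.
  by rewrite ltr0n => /(_ isT); rewrite mulr_natl mulr2n eq_sym -subr_eq0 addrK => /eqP.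
have Gle0 (r : R) : G (0, r : R^o) -> r <= 0.
  by move=> /Gp[/= W0]; rewrite p0.
have Guniq v (r s : R) : G (v, r : R^o) -> G (v, s : R^o) -> r = s.
  suff le (a b : R) : G (v, a : R^o) -> G (v, b : R^o) -> a <= b.
    by move=> Gr Gs; apply/eqP; rewrite eq_le !le.
  move=> Ga Gb; rewrite -subr_le0; apply: Gle0.
  have := GD _ _ Ga (GZ (- 1) _ Gb); rewrite scaleN1r.
  by rewrite -[X in G X -> _]/(v - v, (a - b : R^o)) subrr.
pose F v : R := xget 0 [set r : R | G (v, r : R^o)].
have FP v : W v -> G (v, F v : R^o).
  move=> Wv; have [r Gr] := Gdom v Wv.
  by have /(xgetPex 0) : exists r, [set r : R | G (v, r : R^o)] r by exists r.
exists F; split.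
- move=> u v Wu Wv; apply: (Guniq (u + v)); first exact/FP/WD.
  exact: (GD _ _ (FP _ Wu) (FP _ Wv)).
- move=> r v Wv; apply: (Guniq (r *: v)); first exact/FP/WZ.
  exact: (GZ _ _ (FP _ Wv)).
- by move=> v Wv; have [] := Gp _ (FP _ Wv).
- move=> [v r] /G0G Gvr /=; apply: (Guniq v) => //; apply: FP.
  by have [] := Gp _ Gvr.
Qed.

End HahnBanach.

(** * Regular measures from finitely additive set functions *)

Section HausdorffSeparation.
Variable X : topologicalType.
Hypothesis hX : hausdorff_space X.

Lemma separate_from_compact (D E : set X) : compact D ->
  (forall x, D x -> exists G G', [/\ open G, G x, open G', E `<=` G' & G `&` G' = set0]) ->
  exists G G', [/\ open G, D `<=` G, open G', E `<=` G' & G `&` G' = set0].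
Proof.
move=> /compact_near_coveringP cD sepD.
have [E0|/set0P E0] := eqVneq E set0.
  by exists setT, set0; rewrite E0 setI0; split=> //; [exact: openT|exact: open0].
have [U [EU DU]] : exists U, set_nbhs E U /\ D `<=` ~` closure U.
  have : \forall U \near powerset_filter_from (set_nbhs E), D `<=` ~` closure U.
    have PF : ProperFilter (powerset_filter_from (set_nbhs E)).
      by apply: powerset_filter_from_filter; exact: set_nbhs_pfilter.
    apply: cD => x Dx; have [G [G' [oO Ox oO' EO' OO']]] := sepD x Dx.
    have EO'nb : set_nbhs E G' by apply/set_nbhsP; exists G'; split.
    exists (G, [set N | N `<=` G']).
      by split; [exact: open_nbhs_nbhs|exact: small_set_sub].
    move=> [y U] /= [Oy UO'] /(_ G (open_nbhs_nbhs (conj oO Oy)))[z [Uz Oz]].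
    by rewrite -[False]/(set0 z) -OO'; split=> //; exact: UO'.
  case=> F [FE _ [U FU]] h; exists U; split; first exact: FE.
  exact: h.
have [G' [oO' EO' G'U]] := (set_nbhsP _ _).1 EU.
exists (~` closure U), G'; split=> //.
  by apply: closed_openC; exact: closed_closure.
rewrite -subset0 => x [/= Ux G'x]; apply: Ux; apply: subset_closure; exact: G'U.
Qed.

Lemma separate_compacts (D E : set X) : compact D -> compact E -> D `&` E = set0 ->
  exists G G', [/\ open G, D `<=` G, open G', E `<=` G' & G `&` G' = set0].
Proof.
move=> cD cE DE0; apply: separate_from_compact => // x Dx.
have [|G [G' [oO EO oO' xO' OO']]] := @separate_from_compact E [set x] cE.
  move=> y Ey; have yx : y != x.
    apply/eqP => yx; have : (D `&` E) x by split=> //; rewrite -yx.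
    by rewrite DE0.
  move: hX; rewrite open_hausdorff => /(_ _ _ yx)[[G G'] /=].
  rewrite !inE => -[Oy G'x] [oO oO' OO'].
  by exists G, G'; split=> // _ ->.
by exists G', G; split=> //; [exact: xO'|rewrite setIC].
Qed.

(** A compact set covered by two open sets is the union of two compact pieces,
    one in each. *)
Lemma compact_split (C U V : set X) : compact C -> open U -> open V ->
  C `<=` U `|` V -> exists C1 C2,
    [/\ compact C1, compact C2, C1 `<=` U, C2 `<=` V & C = C1 `|` C2].
Proof.
move=> cC oU oV CUV.
have cI (G : set X) : open G -> compact (C `\` G).
  by move=> oO; apply: compact_closedI => //; exact: open_closedC.
have [|G [G' [oO CO oO' CO' OO']]] := separate_compacts (cI _ oU) (cI _ oV).
  by rewrite -subset0 => x [[Cx Ux] [_ Vx]]; have [] := CUV _ Cx.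
exists (C `\` G), (C `\` G'); split; [exact: cI|exact: cI| | |].
- by move=> x [Cx Ox]; apply: contrapT => Ux; apply: Ox; exact: CO.
- by move=> x [Cx Ox]; apply: contrapT => Ux; apply: Ox; exact: CO'.
- by rewrite -setDIr OO' setD0.
Qed.

End HausdorffSeparation.

Section RegularMeasure.
Local Open Scope ereal_scope.
Variables (R : realType) (X : ptopologicalType) (K : set X) (m : set X -> R).
Hypotheses (hX : hausdorff_space X) (cK : compact K).
Hypotheses (m_ge0 : forall E, (0 <= m E)%R)
  (mU : forall E F, E `&` F = set0 -> m (E `|` F) = (m E + m F)%R)
  (mK : m (~` K) = 0%R).

Let m_le E F : E `<=` F -> (m E <= m F)%R.
Proof.
move=> EF; rewrite -(setDUK EF) mU ?lerDl//.
by rewrite setDE setICA setICr setI0.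
Qed.

Let m0 : m set0 = 0%R.
Proof. by apply/eqP; rewrite eq_le m_ge0 andbT -mK m_le. Qed.

Let m_leU E F : (m (E `|` F) <= m E + m F)%R.
Proof.
rewrite -(setDUK (@subsetUl _ E F)) mU; last by rewrite setDE setICA setICr setI0.
by rewrite lerD2l m_le// => x [[]].
Qed.

(** For an open set, the supremum of [m] over its compact subsets. *)
Definition inner_content (U : set X) : \bar R :=
  ereal_sup [set (m C)%:E | C in [set C | compact C /\ C `<=` U]].

(** The outer measure generated by [inner_content] on open sets. *)
Definition outer_content (E : set X) : \bar R :=
  ereal_inf [set inner_content U | U in [set U | open U /\ E `<=` U]].

Local Notation nu := inner_content.
Local Notation mu := outer_content.

Let nu_ub C U : compact C -> C `<=` U -> (m C)%:E <= nu U.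
Proof. by move=> cC CU; apply: ereal_sup_ubound; exists C. Qed.

Let nu_lem U : nu U <= (m U)%:E.
Proof. by apply: ge_ereal_sup => _ [C [_ CU] <-]; rewrite lee_fin m_le. Qed.

Let nu_ge0 U : 0 <= nu U.
Proof. by rewrite (le_trans _ (nu_ub compact0 (@sub0set _ U)))// lee_fin. Qed.

Let nu_fin U : nu U \is a fin_num.
Proof. by rewrite ge0_fin_numE// (le_lt_trans (nu_lem U))// ltry. Qed.

Let nu_le U V : U `<=` V -> nu U <= nu V.
Proof.
by move=> UV; apply: ereal_sup_le => _ [C [cC CU] <-]; exists C => //; split=> //; exact: subset_trans UV.
Qed.

Let mu_ub E U : open U -> E `<=` U -> mu E <= nu U.
Proof. by move=> oU EU; apply: ereal_inf_lbound; exists U. Qed.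

Let mu_ge0 E : 0 <= mu E.
Proof. by apply: le_ereal_inf_tmp => _ [U _ <-]. Qed.

Let mu_le E F : E `<=` F -> mu E <= mu F.
Proof.
move=> EF; apply: ereal_inf_le_tmp => _ [U [oU FU] <-]; exists U => //.
by split=> //; exact: subset_trans FU.
Qed.

Let mu_fin E : mu E \is a fin_num.
Proof.
rewrite ge0_fin_numE// (le_lt_trans (mu_ub openT (@subsetT _ E)))//.
by rewrite (le_lt_trans (nu_lem _))// ltry.
Qed.

Let mu_open U : open U -> mu U = nu U.
Proof.
move=> oU; apply/eqP; rewrite eq_le mu_ub//=.
by apply: le_ereal_inf_tmp => _ [V [_ UV] <-]; exact: nu_le.
Qed.

Let mu0 : mu set0 = 0.
Proof.
apply/eqP; rewrite eq_le mu_ge0 andbT mu_open; last exact: open0.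
by rewrite (le_trans (nu_lem _))// m0.
Qed.

(** Finite subadditivity on open sets, through [compact_split]. *)
Let m_bigsetU n (U : nat -> set X) C : (forall i, open (U i)) -> compact C ->
  C `<=` \big[setU/set0]_(i < n) U i -> (m C)%:E <= \sum_(i < n) nu (U i).
Proof.
move=> oU; elim: n C => [|n IH] C cC.
  by rewrite !big_ord0 subset0 => ->; rewrite m0.
rewrite !big_ord_recr/= => CU.
have [|C1 [C2 [cC1 cC2 C1U C2U ->]]] := compact_split hX cC _ (oU n) CU.
  by rewrite -bigcup_mkord; apply: bigcup_open.
rewrite (@le_trans _ _ ((m C1)%:E + (m C2)%:E))//.
  by rewrite -EFinD lee_fin.
by rewrite leeD//; [exact: IH|exact: nu_ub].
Qed.

Let nu_bigcup (U : nat -> set X) : (forall i, open (U i)) ->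
  nu (\bigcup_i U i) <= \sum_(i <oo) nu (U i).
Proof.
move=> oU; apply: ge_ereal_sup => _ [C [cC CU] <-].
have := cC; rewrite compact_cover => /(_ nat setT U (fun i _ => oU i) CU)[D _ CD].
pose N := (\max_(i <- finmap.enum_fset D) i)%N.+1.
rewrite (@le_trans _ _ (\sum_(i < N) nu (U i)))//; last first.
  rewrite -(big_mkord xpredT (fun i => nu (U i))).
  by apply: nneseries_lim_ge => i _ _; exact: nu_ge0.
apply: m_bigsetU => // x /CD[i /= iD Uix].
rewrite -bigcup_mkord; exists i => //=.
by rewrite ltnS; exact: (leq_bigmax_seq (F := id)).
Qed.

Let mu_sigma : sigma_subadditive mu.
Proof.
move=> F; apply/lee_addgt0Pr => e e0.
rewrite (le_trans _ (epsilon_trick _ _ (ltW e0)))//.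
have /choice[U HU] n : exists U, [/\ open U, F n `<=` U &
    nu U <= mu (F n) + (e / (2 ^ n.+1)%:R)%:E].
  have en0 : (0 < e / (2 ^ n.+1)%:R)%R by rewrite divr_gt0// ltr0n expn_gt0.
  have [_ [U [oU FU] <-] /ltW h] := lb_ereal_inf_adherent en0 (mu_fin (F n)).
  by exists U.
have oU i : open (U i) by have [] := HU i.
rewrite (@le_trans _ _ (nu (\bigcup_i U i)))//.
  apply: mu_ub; first exact: bigcup_open.
  by apply: subset_bigcup => i _; have [] := HU i.
rewrite (le_trans (nu_bigcup oU))//.
by apply: lee_nneseries => // i _; have [] := HU i.
Qed.

(** A finitely additive set function that is concentrated on a compact set gives
    rise to a regular Borel measure, with the same total mass and at least as
    large on compact sets. *)
Lemma regular_measure_exists :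
  exists mu : {measure set (g_sigma_algebraType (@open X)) -> \bar R},
  [/\ mu setT = (m setT)%:E,
      forall C, compact C -> (m C)%:E <= mu C,
      mu (~` K) = 0 &
      forall M, measurable M -> mu M =
        ereal_sup [set mu C | C in [set C : set X | compact C /\ C `<=` M]] ].
Proof.
pose om : {outer_measure set X -> \bar R} :=
  HB.pack_for {outer_measure set X -> \bar R} mu
    (isOuterMeasure.Build R X mu mu0 mu_ge0 mu_le mu_sigma).
have caraO U : open U -> om.-caratheodory U.
  move=> oU; apply: le_caratheodory_measurable => E.
  rewrite /om/=; apply: le_ereal_inf_tmp => _ [V [oV EV] <-].
  rewrite (@le_trans _ _ (nu (V `&` U) + mu (V `&` ~` U)))//.
    rewrite leeD//; last by apply: mu_le; exact: setSI.
    by apply: mu_ub; [exact: openI|exact: setSI].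
  rewrite -leeBrDr//; apply: ge_ereal_sup => _ [C [cC CVU] <-].
  rewrite leeBrDr// addeC -leeBrDr//.
  have oVC : open (V `&` ~` C).
    by apply: openI => //; apply: closed_openC; exact: compact_closed.
  apply: (@le_trans _ _ (nu (V `&` ~` C))).
    by apply: mu_ub => // x [Vx Ux]; split=> // /CVU[].
  apply: ge_ereal_sup => _ [D [cD DVC] <-].
  rewrite leeBrDr// -EFinD -mU; last by rewrite -subset0 => x [/DVC[]].
  apply: nu_ub; first exact: compactU.
  by move=> x [/DVC[]|/CVU[]].
have caraB : <<s @open X >> `<=` om.-caratheodory.
  apply: smallest_sub => //; split.
  - exact: caratheodory_measurable_set0.
  - by move=> E cE; rewrite setTD; exact: caratheodory_measurable_setC.
  - exact: caratheodory_measurable_bigcup.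
pose B := g_sigma_algebraType (@open X).
have sigmaB : semi_sigma_additive (mu : set B -> \bar R).
  move=> F mF tF mUF; apply: (caratheodory_measure_sigma_additive (mu := om)) => //.
  - by move=> i; exact: (caraB _ (mF i)).
  - exact: (caraB _ mUF).
pose bm : {measure set B -> \bar R} :=
  HB.pack_for {measure set B -> \bar R} (mu : set B -> \bar R)
    (isMeasure.Build _ B R mu mu0 mu_ge0 sigmaB).
have bmE E : bm E = mu E by [].
have clK : closed K by exact: compact_closed.
have muKC : mu (~` K) = 0.
  apply/eqP; rewrite eq_le mu_ge0 andbT mu_open; last exact: closed_openC.
  by rewrite (le_trans (nu_lem _))// mK.
have openM (U : set B) : open (U : set X) -> measurable U.
  by move=> oU; exact: sub_sigma_algebra.
have closedM (C : set B) : closed (C : set X) -> measurable C.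
  by move=> cC; rewrite -(setCK C); apply: measurableC; apply: openM; exact: closed_openC.
exists bm; split.
- rewrite bmE mu_open; last exact: openT.
  apply/eqP; rewrite eq_le nu_lem/=.
  rewrite (le_trans _ (nu_ub cK (@subsetT _ K)))// lee_fin.
  by rewrite -(setvU K) mU ?setICl// mK add0r.
- move=> C cC; rewrite bmE; apply: le_ereal_inf_tmp => _ [U [oU CU] <-].
  exact: nu_ub.
- by [].
- move=> M mM; apply/eqP; rewrite eq_le; apply/andP; split; last first.
    by apply: ge_ereal_sup => _ [C [cC CM] <-]; exact: mu_le.
  apply/lee_addgt0Pr => e e0.
  have [_ [U [oU KMU] <-] /ltW hU] := lb_ereal_inf_adherent e0 (mu_fin (K `\` M)).
  have cC : compact (K `\` U).
    by apply: compact_closedI => //; exact: open_closedC.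
  rewrite (@le_trans _ _ (bm (K `\` U) + e%:E))//; last first.
    rewrite leeD2r//; apply: ereal_sup_ubound; exists (K `\` U) => //.
    split=> // x [Kx Ux]; apply: contrapT => Mx; apply: Ux; exact: KMU.
  have MK0 : mu (M `&` ~` K) = 0.
    apply/eqP; rewrite eq_le mu_ge0 andbT -muKC.
    by apply: mu_le; exact: subIsetr.
  have h1 : bm M <= bm (K `&` M).
    rewrite setIC -[leLHS]/(om M) -[in leLHS](setIT M) -(setUv K) setIUr.
    rewrite (le_trans (outer_measureU2 om _ _))//.
    by rewrite -[X in _ + X]/(mu (M `&` ~` K)) MK0 adde0.
  have h2 : bm K = bm (K `&` M) + bm (K `\` M).
    by rewrite !bmE; exact: (caraB M mM K).
  have h3 : bm K <= bm (K `\` U) + bm U.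
    rewrite -[X in bm X <= _](setUIDK K U) [X in bm X <= _]setUC (le_trans (outer_measureU2 om _ _))//.
    by rewrite leeD2l//; apply: mu_le.
  rewrite (le_trans h1)//; move: h3; rewrite h2 !bmE (mu_open oU) => h3.
  have hU' : nu U <= mu (K `\` M) + e%:E by [].
  rewrite -(@leeD2rE _ (mu (K `\` M)))// (le_trans h3)//.
  by rewrite (le_trans (leeD2l _ hU'))// addeA addeAC.
Qed.

End RegularMeasure.

(** * Riesz representation *)

Section BoundedFunctions.
Variables (R : realType) (X : Type) (K : set X).

(** Functions that are bounded on [K]. *)
Definition bounded_functions : set (X -> R^o) :=
  [set g | exists M : R, forall x, K x -> `|g x : R| <= M].

Local Notation W := bounded_functions.

Lemma bounded_functionsD u v : W u -> W v -> W (u + v).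
Proof.
move=> [M uM] [N vN]; exists (M + N) => x Kx.
by rewrite (le_trans (ler_normD _ _))// lerD ?uM ?vN.
Qed.

Lemma bounded_functionsZ (r : R) v : W v -> W (r *: v).
Proof.
move=> [M vM]; exists (`|r| * M) => x Kx.
by rewrite -[(r *: v) x]/(r * v x) normrM ler_wpM2l ?vM.
Qed.

(** The supremum over [K] of the positive part of [g], which is [0] for
    empty [K]. *)
Definition sup_pos (g : X -> R^o) : R :=
  sup [set r : R | r = 0 \/ exists2 x, K x & r = g x].

Let has_sup_pos g : W g -> has_sup [set r : R | r = 0 \/ exists2 x, K x & r = g x].
Proof.
move=> [M gM]; split; first by exists 0; left.
exists `|M| => _ [->//|[x Kx ->]].
by rewrite (le_trans (ler_norm _))// (le_trans (gM x Kx))// ler_norm.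
Qed.

Lemma sup_pos_ge0 g : W g -> 0 <= sup_pos g.
Proof. by move=> Wg; apply: sup_ubound; [case: (has_sup_pos Wg)|left]. Qed.

Lemma le_sup_pos g x : W g -> K x -> (g x : R) <= sup_pos g.
Proof. by move=> Wg Kx; apply: sup_ubound; [case: (has_sup_pos Wg)|right; exists x]. Qed.

Lemma sup_pos_le g (c : R) : 0 <= c -> (forall x, K x -> (g x : R) <= c) -> sup_pos g <= c.
Proof.
move=> c0 gc; apply: ge_sup; first by exists 0; left.
by move=> _ [->//|[x Kx ->]]; exact: gc.
Qed.

Lemma sup_posD u v : W u -> W v -> sup_pos (u + v) <= sup_pos u + sup_pos v.
Proof.
move=> Wu Wv; apply: sup_pos_le; first by rewrite addr_ge0// sup_pos_ge0.
by move=> x Kx; apply: lerD; exact: le_sup_pos.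
Qed.

Lemma sup_posZ (r : R) u : 0 < r -> W u -> sup_pos (r *: u) = r * sup_pos u.
Proof.
have le (s : R) v : 0 < s -> W v -> sup_pos (s *: v) <= s * sup_pos v.
  move=> s0 Wv; apply: sup_pos_le; first by rewrite mulr_ge0// ?sup_pos_ge0// ltW.
  by move=> x Kx; rewrite -[leLHS]/(s * v x) ler_pM2l// le_sup_pos.
move=> r0 Wu; apply/eqP; rewrite eq_le le//=.
rewrite mulrC -ler_pdivlMr// mulrC -[u in leLHS](scale1r u) -(mulVf (lt0r_neq0 r0)).
by rewrite -scalerA le ?invr_gt0//; exact: bounded_functionsZ.
Qed.

End BoundedFunctions.

Section LayerCake.
Variable R : realType.

(** The sum [s] is [y] rounded down to a multiple of [h]. *)
Lemma layer_sum (n : nat) (h y : R) : 0 < h -> 0 <= y < n.+1%:R * h ->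
  let s := h * \sum_(j < n) (j.+1%:R * h <= y)%R%:R in s <= y <= s + h.
Proof.
move=> h0 /andP[y0 yn] /=; set s := fun n => \sum_(j < n) ((j.+1%:R * h <= y)%R%:R : R).
have sn k : s k <= k%:R.
  rewrite -[k in leRHS]card_ord -sumr_const; apply: ler_sum => j _.
  by rewrite lern1 leq_b1.
have sfull k : k%:R * h <= y -> s k = k%:R.
  move=> ky; rewrite -[k in RHS]card_ord -sumr_const; apply: eq_bigr => j _.
  by rewrite (le_trans _ ky)// ler_pM2r// ler_nat.
have sle k : h * s k <= y.
  elim: k => [|k IH]; first by rewrite /s big_ord0 mulr0.
  have [ky|ky] := leP (k.+1%:R * h) y; first by rewrite sfull// mulrC.
  by rewrite /s big_ord_recr/= [k.+1%:R * h <= y]leNgt ky addr0.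
rewrite sle/= {sle}; elim: n yn => [|n IH] yn.
  by rewrite /s big_ord0 mulr0 add0r ltW// -(mul1r h).
have [ny|ny] := leP (n.+1%:R * h) y.
  by rewrite -/(s n.+1) sfull// mulrC -[X in _ + X]mul1r -mulrDl natr1 ltW.
by rewrite /s big_ord_recr/= [n.+1%:R * h <= y]leNgt ny addr0 IH.
Qed.

End LayerCake.

Section Riesz.
Variables (R : realType) (X : ptopologicalType) (K : set X).
Hypotheses (hX : hausdorff_space X) (cK : compact K).
Local Notation W := (bounded_functions K).
Variable F : (X -> R^o) -> R.
Hypotheses (FD : forall u v, W u -> W v -> F (u + v) = F u + F v)
  (FZ : forall (r : R) v, W v -> F (r *: v) = r * F v)
  (F_ge0 : forall v, W v -> (forall x, K x -> 0 <= (v x : R)) -> 0 <= F v).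

Let ind (E : set X) : X -> R^o := \1_E.
Let m E := F (ind E).

Let W_ind E : W (ind E).
Proof. by exists 1 => x _; rewrite /ind indicE ger0_norm// lern1 leq_b1. Qed.

Let F_le u v : W u -> W v -> (forall x, K x -> (u x : R) <= v x) -> F u <= F v.
Proof.
move=> Wu Wv uv; rewrite -subr_ge0 -mulN1r -FZ// -FD//; last exact: bounded_functionsZ.
apply: F_ge0 => [|x Kx]; first by apply: bounded_functionsD => //; exact: bounded_functionsZ.
by rewrite -[_ x]/(v x + -1 * u x) mulN1r subr_ge0 uv.
Qed.

Let B := g_sigma_algebraType (@open X).

Let open_measurable (U : set X) : open U -> measurable (U : set B).
Proof. by move=> oU; exact: sub_sigma_algebra. Qed.

Let closed_measurable (C : set X) : closed C -> measurable (C : set B).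
Proof.
move=> cC; rewrite -(setCK C); apply: measurableC; apply: open_measurable.
exact: closed_openC.
Qed.

Let mK : measurable (K : set B).
Proof. by apply: closed_measurable; exact: compact_closed. Qed.

Let continuous_measurable (f : X -> R) : continuous f ->
  measurable_fun [set: B] (f : B -> R).
Proof.
move=> /continuousP cf; apply: (measurability _ (RGenOpens.measurableE R)).
move=> _ [_ [a [b ->] <-]]; rewrite setTI; apply: open_measurable.
exact/cf/itv_open.
Qed.

Section Integral.
Variable mu : {measure set B -> \bar R}.
Hypotheses (muT : mu setT = (m setT)%:E)
  (m_mu : forall C, compact C -> ((m C)%:E <= mu C)%E)
  (muK : mu (~` K) = 0%E).

Let mu_fin E : measurable E -> (mu E < +oo)%E.
Proof.
move=> mE; apply: (@le_lt_trans _ _ (mu setT)); last by rewrite muT ltry.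
by apply: le_measure; rewrite ?inE.
Qed.

Let setTDK : [set: B] `\` ~` K = K.
Proof. by rewrite setTD setCK. Qed.

Let integrableK (f : X -> R) : continuous f -> W f ->
  mu.-integrable K (EFin \o (f : B -> R)).
Proof.
move=> cf [M fM]; apply: measurable_bounded_integrable => //.
- exact: mu_fin.
- by apply: measurable_funTS; exact: continuous_measurable.
- by exists M; split; [exact: num_real|move=> N MN x Kx; exact: le_trans (fM x Kx) (ltW MN)].
Qed.

Let muKE : mu K = (m setT)%:E.
Proof.
have mCK : measurable (~` K : set B) by exact: measurableC.
rewrite -muT -(setvU K) measureU//; last by rewrite setICl.
by rewrite -[LHS]add0e -muK.
Qed.

(** The staircase function with steps of height [h] below [f] has [F]-value at
    most its integral, as its level sets in [K] are compact. *)
Let F_le_integral_ge0 (f : X -> R) : continuous f -> W f ->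
  (forall x, K x -> 0 <= f x) ->
  ((F f)%:E <= \int[mu]_(x in K) (f x)%:E)%E.
Proof.
move=> cf Wf f0; apply/lee_addgt0Pr => e e0.
have mT0 : 0 <= m setT.
  by apply: F_ge0 => // x _; rewrite /ind indicT.
pose h : R := e / (m setT + 1).
have h0 : 0 < h by rewrite divr_gt0// ltr_wpDl.
have hmT : h * m setT <= e.
  by rewrite /h mulrAC ler_pdivrMr ?ltr_wpDl// ler_pM2l// lerDl.
have [M fM] := Wf; pose n := Num.trunc (M / h).
have fn x : K x -> 0 <= f x < n.+1%:R * h.
  move=> Kx; rewrite f0//= (le_lt_trans (ler_norm _))// (le_lt_trans (fM x Kx))//.
  by rewrite -ltr_pdivrMr// truncnS_gt.
pose E (j : nat) := K `&` [set x | j.+1%:R * h <= f x].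
have cE j : compact (E j).
  apply: compact_closedI => //.
  have := @closed_comp _ _ f [set r | j.+1%:R * h <= r].
  by apply=> [x _|]; [exact: cf|exact: closed_ge].
have mE j : measurable (E j : set B).
  by apply: closed_measurable; exact: compact_closed.
pose s k : X -> R^o := \sum_(j < k) ind (E j).
have sE k x : K x -> s k x = \sum_(j < k) (j.+1%:R * h <= f x)%R%:R.
  move=> Kx; rewrite /s fct_sumE; apply: eq_bigr => j _.
  rewrite /ind indicE; congr (nat_of_bool _)%:R.
  by apply/idP/idP => [/set_mem[]//|jf]; apply/mem_set.
have [Ws [is_ Fs]] : W (s n) /\ mu.-integrable K (EFin \o (s n : B -> R)) /\
    ((F (s n))%:E <= \int[mu]_(x in K) (s n x : R)%:E)%E.
  elim: n {fn} => [|k [Ws [is_ Fs]]].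
    rewrite /s big_ord0; split; [|split].
    - by exists 0 => x _; rewrite normr0.
    - exact: integrable0.
    - rewrite -[X in F X](scale0r (ind setT)) FZ// mul0r.
      by rewrite integral0_eq.
  have sS : s k.+1 = s k + ind (E k) by rewrite /s big_ord_recr.
  have iE : mu.-integrable K (EFin \o (ind (E k) : B -> R)).
    apply: measurable_bounded_integrable => //; first exact: mu_fin.
      by apply: measurable_funTS; exact: measurable_indic.
    exists 1; split; [exact: num_real|move=> N N1 x _; apply: le_trans (ltW N1)].
    by rewrite /ind /= indicE ger0_norm// lern1 leq_b1.
  have sSE : EFin \o (s k.+1 : B -> R) =
      ((EFin \o (s k : B -> R)) \+ (EFin \o (ind (E k) : B -> R)))%E.
    by apply/funext => x; rewrite sS /= EFinD.
  rewrite sSE; split; [by rewrite sS; exact: bounded_functionsD|split; first exact: integrableD].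
  have -> : (\int[mu]_(x in K) (s k.+1 x : R)%:E =
      \int[mu]_(x in K) (s k x : R)%:E + \int[mu]_(x in K) (ind (E k) x : R)%:E)%E.
    by rewrite -[RHS]integralD_EFin//; apply: eq_integral => x _; rewrite sS.
  rewrite sS FD// EFinD leeD// integral_indic//.
  rewrite (_ : E k `&` K = E k); last by apply/setIidPl => x [].
  exact: m_mu.
have hs : (h%:E * \int[mu]_(x in K) (s n x : R)%:E <= \int[mu]_(x in K) (f x)%:E)%E.
  rewrite -integralZl//; apply: le_integral => //.
  - exact: integrableZl.
  - exact: integrableK.
  - move=> x /set_mem Kx; rewrite -EFinM lee_fin sE//.
    by have /andP[] := layer_sum h0 (fn x Kx).
apply: (@le_trans _ _ (F (h *: s n + h *: ind setT))%:E).
  rewrite lee_fin; apply: F_le => //; first by apply: bounded_functionsD; exact: bounded_functionsZ.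
  move=> x Kx; rewrite -[leRHS]/(h * s n x + h * ind setT x) sE// /ind indicT mulr1.
  by have /andP[] := layer_sum h0 (fn x Kx).
rewrite FD ?FZ//; [|exact: bounded_functionsZ|exact: bounded_functionsZ].
rewrite EFinD leeD ?lee_fin//.
by rewrite (le_trans _ hs)// EFinM lee_pmul2l.
Qed.

Let F_le_integral (f : X -> R) : continuous f -> W f ->
  ((F f)%:E <= \int[mu]_(x in K) (f x)%:E)%E.
Proof.
move=> cf Wf; have [M fM] := Wf.
pose c : X -> R^o := M *: ind setT.
have cE x : c x = M :> R by rewrite -[c x]/(M * ind setT x) /ind indicT mulr1.
have Wc : W c by exact: bounded_functionsZ.
have cfc : continuous (f + c : X -> R).
  move=> x; apply: (@continuousD _ _ _ f c); first exact: cf.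
  by rewrite (_ : c = cst M); [exact: cvg_cst|apply/funext].
have := F_le_integral_ge0 cfc (bounded_functionsD Wf Wc).
have -> : (\int[mu]_(x in K) ((f + c) x : R)%:E =
    \int[mu]_(x in K) (f x)%:E + (M * m setT)%:E)%E.
  rewrite EFinM -muKE -(integral_cst mu mK) -integralD//; last 2 first.
  - exact: integrableK.
  - apply: measurable_bounded_integrable => //; first exact: mu_fin.
    exact: bounded_cst.
  by apply: eq_integral => x _; rewrite -EFinD -(cE x).
rewrite FD// FZ// EFinD leeD2rE//; apply => x Kx.
rewrite -[leRHS]/(f x + c x) cE -lerBlDr sub0r.
by have := fM x Kx; rewrite ler_norml => /andP[].
Qed.

Lemma integral_functional (f : X -> R) : continuous f -> W f ->
  mu.-integrable setT (fun x : B => (f x)%:E) /\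
  (\int[mu]_(x in [set: B]) (f x)%:E)%E = (F f)%:E.
Proof.
move=> cf Wf; have mCK : measurable (~` K : set B) by exact: measurableC.
have mf : measurable_fun [set: B] (fun x : B => (f x)%:E).
  by apply/measurable_EFinP; exact: continuous_measurable.
have intf : mu.-integrable setT (fun x : B => (f x)%:E).
  apply/(negligible_integrable mCK _ mf muK) => //.
  by rewrite setTDK; exact: integrableK.
split=> //; rewrite (negligible_integral mCK _ intf muK)// setTDK.
apply/eqP; rewrite eq_le F_le_integral// andbT.
have Nf : (-1 : R) *: (f : X -> R^o) = (fun x => - f x).
  by apply/funext => x; rewrite -[LHS]/(-1 * f x) mulN1r.
have FN : F (fun x => - f x) = - F f by rewrite -Nf FZ// mulN1r.
have := @F_le_integral (fun x => - f x); rewrite FN EFinN.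
rewrite (_ : (\int[mu]_(x in K) (- f x)%:E = \int[mu]_(x in K) - (f x)%:E)%E)//.
rewrite integralN//; last exact/integrable_add_def/integrableK.
rewrite leeN2; apply; first by move=> x; apply: continuousN; exact: cf.
by rewrite -Nf; exact: bounded_functionsZ.
Qed.

End Integral.

(** Riesz representation, for a positive functional given on all functions
    that are bounded on the compact set [K]. *)
Lemma riesz_representation :
  exists mu : {measure set B -> \bar R},
  [/\ (mu setT < +oo)%E,
      mu (~` K) = 0%E,
      forall M, measurable M -> mu M =
        ereal_sup [set mu C | C in [set C : set X | compact C /\ C `<=` M]] &
      forall f : X -> R, continuous f -> W f ->
        mu.-integrable setT (fun x : B => (f x)%:E) /\
        (\int[mu]_(x in [set: B]) (f x)%:E)%E = (F f)%:E].
Proof.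
have m_ge0 E : 0 <= m E by apply: F_ge0 => // x _; rewrite /ind indicE.
have mU E G : E `&` G = set0 -> m (E `|` G) = m E + m G.
  move=> EG0; rewrite /m -FD//; congr F; apply/funext => x.
  rewrite -[RHS]/(ind E x + ind G x) /ind !indicE in_setU -natrD.
  congr (_%:R); have [xE|] := boolP (x \in E); have [xG|//] := boolP (x \in G) => //.
  by move/set_mem: xE; move/set_mem: xG => Gx Ex; have : (E `&` G) x by []; rewrite EG0.
have mK0 : m (~` K) = 0.
  apply/eqP; rewrite eq_le m_ge0 andbT -oppr_ge0 -mulN1r -FZ//.
  apply: F_ge0; first exact: bounded_functionsZ.
  move=> x Kx; rewrite -[leRHS]/(-1 * ind (~` K) x) /ind indicE.
  by rewrite memNset ?mulr0//= => /(_ Kx).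
have [mu [muT m_mu muK mureg]] := regular_measure_exists hX cK m_ge0 mU mK0.
exists mu; split=> //; first by rewrite muT ltry.
by move=> f cf Wf; exact: integral_functional.
Qed.

End Riesz.

(** * Topology of the character space *)

Section CharacterTopology.
Variables (R : realType) (A : comAlgType R).

Lemma character_ext (x y : character A) :
  (forall a, gelfand a x = gelfand a y) -> x = y.
Proof.
case: x y => [f cf] [g cg] E.
have fg : f = g by apply/funext => a; exact: E.
move: cf cg {E}; rewrite fg => -[[c1] [c2] [c3]] [[d1] [d2] [d3]].
by rewrite (Prop_irrelevance c1 d1) (Prop_irrelevance c2 d2) (Prop_irrelevance c3 d3).
Qed.

Lemma cvg_character (F : set_system (character A)) (x : character A) : Filter F ->
  (forall a, gelfand a y @[y --> F] --> gelfand a x) -> F --> x.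
Proof.
move=> FF cvgF; apply/cvg_sup => a N.
rewrite nbhsE => -[_ [[V oV <-] Vx] VN].
by apply: filterS VN _; apply: (cvgF a); exact: open_nbhs_nbhs.
Qed.

Lemma gelfand_continuous (a : A) : continuous (gelfand a : character A -> R).
Proof.
move=> x N Nx; have /cvg_sup/(_ a) h : nbhs x --> x by [].
exact: h _ (@initial_continuous _ _ (@gelfand R A a) x N Nx).
Qed.

Lemma character_hausdorff : hausdorff_space (character A).
Proof.
move=> x y xy; apply: character_ext => a.
apply: (@Rhausdorff R) => U V Ux Vy.
have [z [Uz Vz]] := xy _ _ (gelfand_continuous Ux) (gelfand_continuous Vy).
by exists (gelfand a z).
Qed.

Lemma closed_gelfand_ge (a : A) (c : R) : closed [set x : character A | c <= gelfand a x].
Proof.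
have := @closed_comp _ _ (gelfand a : character A -> R) [set r | c <= r].
by apply=> [x _|]; [exact: gelfand_continuous|exact: closed_ge].
Qed.

Variables (rho : A -> R) (S : set A).
Hypothesis rho_seminorm : submultiplicative_seminorm rho.

(** A continuous character has norm at most one. *)
Lemma gelfand_spectrum_le : gelfand_spectrum rho =
  [set x | forall a, `|gelfand a x| <= rho a].
Proof.
have rho0 := ssn_ge0 rho_seminorm.
rewrite eqEsubset; split=> x; last first.
  move=> /= xle a e e0; exists e => // b bae.
  by rewrite -gelfandB (le_lt_trans (xle _)).
move=> /= cx a; rewrite leNgt; apply/negP => ra.
have [delta d0 cd] := cx 0 1 ltr01.
have x0 : 0 < `|gelfand a x| by exact: le_lt_trans ra.
have r1 : rho a / `|gelfand a x| < 1 by rewrite ltr_pdivrMr// mul1r.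
have r0 : 0 <= rho a / `|gelfand a x| by rewrite divr_ge0.
have [k] : exists k, (rho a / `|gelfand a x|) ^+ k.+1 < delta.
  have := @cvg_expr R (rho a / `|gelfand a x|); rewrite ger0_norm// => /(_ r1).
  move/cvgr_lt => /(_ delta d0) [k _ /(_ k.+1)]; rewrite /= leqnSn => /(_ isT) ?.
  by exists k.
move=> kd; pose b := (`|gelfand a x|^-1 *: a) ^+ k.+1.
have : `|gelfand b x| < 1.
  have := cd b; rewrite subr0 -gelfandB subr0; apply; apply: le_lt_trans kd.
  rewrite (le_trans (ssnX rho_seminorm _ _))// lerXn2r ?nnegrE//.
  by rewrite (ssnZ rho_seminorm) ger0_norm ?invr_ge0// mulrC.
rewrite gelfandX gelfandZ normrX normrM normfV normr_id mulVf ?gt_eqF//.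
by rewrite expr1n ltxx.
Qed.

Lemma closed_spectrum_nonneg :
  closed (gelfand_spectrum rho `&` nonneg_characters S).
Proof.
rewrite gelfand_spectrum_le; apply: closedI.
  rewrite (_ : mkset _ = \bigcap_a ([set x | - rho a <= gelfand a x] `&`
      [set x | - rho a <= gelfand (- a) x])).
    by apply: closed_bigI => a _; apply: closedI; exact: closed_gelfand_ge.
  apply/seteqP; split=> x h a.
    by have := h a; rewrite ler_norml /= gelfandN lerN2 => /andP[].
  by have := h a I; rewrite ler_norml /= gelfandN lerN2 => -[-> ->].
rewrite (_ : nonneg_characters S = \bigcap_(s in S) [set x | 0 <= gelfand s x])//.
by apply: closed_bigI => a _; exact: closed_gelfand_ge.
Qed.

(** An ultrafilter of bounded characters converges pointwise, and its limit is a
    character. *)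
Lemma compact_spectrum_nonneg :
  compact (gelfand_spectrum rho `&` nonneg_characters S).
Proof.
apply: (@subclosed_compact _ _ (gelfand_spectrum rho)).
- exact: closed_spectrum_nonneg.
- rewrite gelfand_spectrum_le compact_ultra => F UF FK.
  have PF : ProperFilter F by exact: ultra_proper.
  have lim_ex a : exists c : R, gelfand a x @[x --> F] --> c /\ `|c| <= rho a.
    have : compact `[- rho a, rho a] by exact: segment_compact.
    move=> /(_ (gelfand a x @[x --> F]) _) [|c [ca clc]].
      apply: (@filterS _ F _ _ _ _ FK) => x /= /(_ a); rewrite ler_norml => /andP[? ?].
      by rewrite in_itv/=; apply/andP.
    exists c; split; last by move: ca; rewrite /= in_itv/= ler_norml.
    move=> N Nc; have [//|FN] := in_ultra_setVsetC (gelfand a @^-1` N) UF.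
    have [r [Nr ]] := clc (~` N) N FN Nc; by [].
  have [f fP] := choice lim_ex.
  have fcvg a : gelfand a x @[x --> F] --> f a by case: (fP a).
  have lim_eq a c : gelfand a x @[x --> F] --> c -> f a = c.
    exact: (cvg_unique (@Rhausdorff R) (fcvg _)).
  have [x xE] : exists x : character A, forall a, gelfand a x = f a.
    apply: character_exists => [a b|r a|a b|].
    - apply: lim_eq; rewrite (_ : gelfand (a + b) = fun x => gelfand a x + gelfand b x).
        exact: cvgD.
      by apply/funext => x; rewrite gelfandD.
    - apply: lim_eq; rewrite (_ : gelfand (r *: a) = fun x => r * gelfand a x).
        by apply: cvgM => //; exact: cvg_cst.
      by apply/funext => x; rewrite gelfandZ.
    - apply: lim_eq; rewrite (_ : gelfand (a * b) = fun x => gelfand a x * gelfand b x).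
        exact: cvgM.
      by apply/funext => x; rewrite gelfandM.
    - apply: lim_eq; rewrite (_ : gelfand 1 = fun x => 1).
        exact: cvg_cst.
      by apply/funext => x; rewrite gelfand1.
  exists x; split; first by move=> a; rewrite xE; case: (fP a).
  by apply: cvg_character => a; rewrite xE.
- by move=> x [].
Qed.

End CharacterTopology.

(** * The closure of a module *)

Section Closure.
Variables (R : realType) (A : comAlgType R) (rho : A -> R).
Hypothesis rho_seminorm : submultiplicative_seminorm rho.
Variables (d : nat) (S : set A).
Hypotheses (d_gt0 : (0 < d)%N) (S_module : power_module d S).

Let T := ssn_closure rho S.

Let coneS : cone S. Proof. by case: S_module. Qed.
Let rho0 a : 0 <= rho a. Proof. exact: ssn_ge0. Qed.

Lemma cone_ssn_closure : cone T.
Proof.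
have [_ SD SZ] := coneS; split.
- by exists 0; apply: sub_ssn_closure => //; exact: cone0.
- move=> a b Ta Tb e e0; have e20 : 0 < e / 2 by rewrite divr_gt0.
  have [s Ss sa] := Ta _ e20; have [t St tb] := Tb _ e20.
  exists (s + t); first exact: SD.
  rewrite opprD addrACA [e]splitr.
  by rewrite (le_lt_trans (ssnD rho_seminorm _ _))// ltrD.
- move=> r a; rewrite le_eqVlt => /predU1P[<- _|r0 Ta] e e0.
    by rewrite scale0r; exists 0; [exact: cone0|rewrite subrr ssn0].
  have [s Ss sa] := Ta (e / r) (divr_gt0 e0 r0).
  exists (r *: s); first by apply: SZ => //; exact: ltW.
  by rewrite -scalerBr (ssnZ rho_seminorm) gtr0_norm// mulrC -ltr_pdivlMr.
Qed.

(** Limits of [2 * d]-th powers are multipliers of the closure; hence the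
    multipliers contain a neighborhood of [1]. *)
Lemma stabilizer_ssn_closure : exists2 delta : R, 0 < delta &
  forall a (r : R), 0 < r -> rho a <= r * delta -> stabilizer T (r%:A + a).
Proof.
have n0 : (0 < 2 * d)%N by rewrite muln_gt0.
have [delta delta0 Hdelta] := approx_root rho_seminorm n0.
exists delta => // a r r0 ar.
have E : r%:A + a = r *: (1 + r^-1 *: a).
  by rewrite scalerDr scalerA divff ?gt_eqF// scale1r.
rewrite E; apply: stabilizerZ; [exact: cone_ssn_closure|exact: ltW|].
have {}ar : rho (r^-1 *: a) <= delta.
  by rewrite (ssnZ rho_seminorm) gtr0_norm ?invr_gt0// mulrC ler_pdivrMr// mulrC.
move: (r^-1 *: a) ar => {E r0} c cdelta t Tt e e0.
have e20 : 0 < e / 2 by rewrite divr_gt0.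
have c1 : 0 < rho (1 + c) + 1 by rewrite ltr_wpDl.
have [s Ss ts] := Tt (e / 2 / (rho (1 + c) + 1)) (divr_gt0 e20 c1).
have s1 : 0 < rho s + 1 by rewrite ltr_wpDl.
have [b bc] := Hdelta c cdelta (e / 2 / (rho s + 1)) (divr_gt0 e20 s1).
exists (b ^+ (2 * d) * s); first by case: S_module => _ _; exact.
have -> : (1 + c) * t - b ^+ (2 * d) * s =
    (1 + c) * (t - s) + (1 + c - b ^+ (2 * d)) * s by ring.
rewrite (le_lt_trans (ssnD rho_seminorm _ _))// [e]splitr ltrD//.
  rewrite (le_lt_trans (ssnM rho_seminorm _ _))//.
  rewrite (@le_lt_trans _ _ ((rho (1 + c) + 1) * rho (t - s)))//.
    by rewrite ler_wpM2r// lerDl.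
  by rewrite mulrC -ltr_pdivlMr.
rewrite (le_lt_trans (ssnM rho_seminorm _ _))//.
rewrite (@le_lt_trans _ _ (rho (1 + c - b ^+ (2 * d)) * (rho s + 1)))//.
  by rewrite ler_wpM2l// lerDl.
by rewrite -ltr_pdivlMr.
Qed.

(** A character that is nonnegative on the closure is continuous: it is
    nonnegative at [r + a] as soon as [rho a] is small relative to [r]. *)
Lemma nonneg_characters_ssn_closure :
  nonneg_characters T `<=` gelfand_spectrum rho `&` nonneg_characters S.
Proof.
move=> x xT; split; last by move=> s Ss; apply: xT; exact: sub_ssn_closure.
have [delta delta0 stT] := stabilizer_ssn_closure.
have T1 : T 1 by apply: sub_ssn_closure => //; case: S_module.
have xle a (r : R) : 0 < r -> rho a <= r * delta -> - r <= gelfand a x.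
  move=> r0 ar; have := xT _ (stT a r r0 ar 1 T1).
  by rewrite mulr1 gelfandD gelfandZ gelfand1 mulr1 -lerBlDl sub0r.
move=> a e e0; have e20 : 0 < e / 2 by rewrite divr_gt0.
exists (e / 2 * delta); first by rewrite mulr_gt0.
move=> b bae; rewrite -gelfandB (@le_lt_trans _ _ (e / 2))//; last first.
  by rewrite ltr_pdivrMr// ltr_pMr// ltr1n.
rewrite ler_norml xle//=; last exact: ltW.
by rewrite -lerN2 -(gelfandN (b - a) x) xle// ssnN// ltW.
Qed.

(** An element that is positive on the continuous characters nonnegative on [S]
    is a limit of elements of [S]. *)
Lemma ssn_closure_positive f :
  (forall x, (gelfand_spectrum rho `&` nonneg_characters S) x -> 0 < gelfand f x) ->
  T f.
Proof.
move=> fpos; apply: positivstellensatz.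
- exact: cone_ssn_closure.
- by apply: sub_ssn_closure => //; case: S_module.
- have [delta delta0 stT] := stabilizer_ssn_closure.
  move=> a; have r0 : 0 < rho a / delta + 1 by rewrite ltr_wpDl// divr_ge0// ltW.
  exists (rho a / delta + 1) => //; apply: stT => //.
  by rewrite mulrDl divfK ?gt_eqF// mul1r lerDl ltW.
- by move=> x xT; apply: fpos; exact: nonneg_characters_ssn_closure.
Qed.

Lemma cone_seminorm_le (a s : A) : S s -> cone_seminorm S rho a <= rho (a + s).
Proof. by move=> Ss; apply: ge_inf; [exists 0 => _ [p _ <-]|exists s]. Qed.

Lemma cone_seminorm_upper_bound b (c : R) : 0 < c ->
  (forall x, (gelfand_spectrum rho `&` nonneg_characters S) x -> gelfand b x < c) ->
  cone_seminorm S rho b <= c * rho 1.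
Proof.
move=> c0 bc; apply/ler_addgt0Pr => e e0.
have [|s Ss cbs] := @ssn_closure_positive (c%:A - b) _ e e0.
  by move=> x Kx; rewrite gelfandB gelfandZ gelfand1 mulr1 subr_gt0 bc.
rewrite (le_trans (cone_seminorm_le b Ss))//.
have -> : b + s = c%:A - (c%:A - b - s) by ring.
rewrite (le_trans (ssnD rho_seminorm _ _))// ssnN// (ssnZ rho_seminorm) gtr0_norm//.
by rewrite lerD2l ltW.
Qed.

End Closure.

(** * Representing measures *)

Section Representation.
Variables (R : realType) (A : comAlgType R) (ne : [set: character A] !=set0).
Variable rho : A -> R.
Hypothesis rho_seminorm : submultiplicative_seminorm rho.
Variables (P : pred A) (B : subLmodType P) (d : nat) (S : set A).
Hypotheses (d_gt0 : (0 < d)%N) (S_module : power_module d S).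
Variables (L : {linear B -> R^o}).

Let K := gelfand_spectrum rho `&` nonneg_characters S.

Let gelfand_bounded a : bounded_functions K (gelfand a : character A -> R^o).
Proof.
exists (rho a) => x [+ _]; rewrite gelfand_spectrum_le//; exact.
Qed.

Lemma representing_measure_exists (D : R) : 0 < D ->
  (forall b : B, (L b : R) <= D * cone_seminorm S rho (val b)) ->
  exists mu : {measure set (borel_charspace ne) -> \bar R},
     [/\ radon mu, support_contained mu K &
         forall b : B,
           mu.-integrable [set: borel_charspace ne]
             (fun alpha => (gelfand (val b) alpha)%:E) /\
           (\int[mu]_alpha (gelfand (val b) alpha)%:E)%E = (L b)%:E].
Proof.
move=> D0 LD; pose V := character A -> R^o.
pose p (g : V) : R := D * rho 1 * sup_pos K g.
have C0 : 0 <= D * rho 1 by rewrite mulr_ge0 ?(ssn_ge0 rho_seminorm)// ltW.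
have Lp (b : B) : (L b : R) <= p (gelfand (val b)).
  apply: (le_trans (LD b)); rewrite /p -mulrA ler_pM2l//.
  set s := sup_pos K _; have s0 : 0 <= s by exact: sup_pos_ge0.
  apply/ler_addgt0Pr => e e0; have r1 : 0 < rho 1 + 1.
    by rewrite ltr_wpDl// (ssn_ge0 rho_seminorm).
  have c0 : 0 < s + e / (rho 1 + 1) by rewrite ltr_wpDl// divr_gt0.
  apply: (le_trans (@cone_seminorm_upper_bound _ _ _ rho_seminorm _ _ d_gt0 S_module _ _ c0 _)).
    move=> x Kx; rewrite ltr_pwDr ?divr_gt0//.
    exact: (le_sup_pos (gelfand_bounded (val b)) Kx).
  rewrite mulrC mulrDr lerD2l mulrCA ger_pMr//.
  by rewrite ler_pdivrMr// mul1r lerDl.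
pose G0 : set (V * R^o) := [set x | exists b : B, x = (gelfand (val b) : V, L b)].
have domG0 : dominated_graph (bounded_functions K) p G0.
  split.
  - exists 0; congr (_, _); last by rewrite raddf0.
    by apply/funext => x; rewrite [val 0]raddf0 -(subrr (1 : A)) gelfandB subrr.
  - move=> _ _ [b ->] [c ->]; exists (b + c); congr (_, _); last by rewrite raddfD.
    by apply/funext => x; rewrite raddfD gelfandD.
  - move=> r _ [b ->]; exists (r *: b); congr (_, _); last by rewrite linearZ.
    by apply/funext => x; rewrite linearZ gelfandZ.
  - by move=> _ [b ->]; split; [exact: gelfand_bounded|exact: Lp].
have pD u v : bounded_functions K u -> bounded_functions K v -> p (u + v) <= p u + p v.
  by move=> Wu Wv; rewrite /p -mulrDr ler_wpM2l// sup_posD.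
have pZ (r : R) v : 0 < r -> bounded_functions K v -> p (r *: v) = r * p v.
  by move=> r0 Wv; rewrite /p sup_posZ// mulrCA.
have [F [FD FZ Fp FL]] := hahn_banach (@bounded_functionsD _ _ K)
  (@bounded_functionsZ _ _ K) pD pZ domG0.
have F_ge0 v : bounded_functions K v -> (forall x, K x -> 0 <= (v x : R)) -> 0 <= F v.
  move=> Wv v0; rewrite -lerN2 oppr0 -mulN1r -FZ//.
  rewrite (le_trans (Fp _ (bounded_functionsZ _ Wv)))//.
  rewrite /p mulr_ge0_le0//; apply: sup_pos_le => // x Kx.
  by rewrite -[leLHS]/(-1 * v x) mulN1r oppr_le0 v0.
have cK : compact (K : set (charspace ne)) by exact: compact_spectrum_nonneg.
have [mu [mu_fin muK mureg muF]] :=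
  @riesz_representation R (charspace ne) K (@character_hausdorff R A) cK F FD FZ F_ge0.
exists mu; split.
- split; last exact: mureg.
  by move=> x; exists setT; split=> //; exact: openT.
- move=> M mM MK; apply/eqP; rewrite eq_le measure_ge0 andbT -muK.
  apply: le_measure; rewrite ?inE//.
    apply: measurableC; rewrite -(setCK K); apply: measurableC; apply: sub_sigma_algebra.
    by apply: closed_openC; exact: closed_spectrum_nonneg.
  by move=> x Mx Kx; rewrite -[False]/(set0 x) -MK.
- move=> b; have <- : F (gelfand (val b)) = L b.
    by apply: (FL (gelfand (val b) : V, L b)); exists b.
  by apply: muF; [exact: gelfand_continuous|exact: gelfand_bounded].
Qed.

Lemma representing_measure_bound (mu : {measure set (borel_charspace ne) -> \bar R}) :
  radon mu -> support_contained mu K ->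
  (forall b : B,
     mu.-integrable [set: borel_charspace ne]
       (fun alpha => (gelfand (val b) alpha)%:E) /\
     (\int[mu]_alpha (gelfand (val b) alpha)%:E)%E = (L b)%:E) ->
  exists2 D : R, 0 < D &
     forall b : B, (L b : R) <= D * cone_seminorm S rho (val b).
Proof.
move=> [mu_lf _] mu_supp muL.
have cK : compact (K : set (charspace ne)) by exact: compact_spectrum_nonneg.
have clK : closed (K : set (charspace ne)) by exact: closed_spectrum_nonneg.
have mCK : measurable (~` K : set (borel_charspace ne)).
  by apply: sub_sigma_algebra; exact: closed_openC.
have mK : measurable (K : set (borel_charspace ne)).
  by rewrite -(setCK K); exact: measurableC.
have muCK : mu (~` K) = 0%E by apply: mu_supp => //; rewrite setICl.
(* a locally finite measure is finite on compact sets *)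
have muK : (mu K < +oo)%E.
  have /choice[U HU] := mu_lf.
  have := cK; rewrite compact_cover => /(_ (charspace ne) K U) [||D _ KD].
  - by move=> x _; case: (HU x).
  - by move=> x Kx; exists x => //; case: (HU x).
  have mU x : measurable (U x : set (borel_charspace ne)).
    by apply: sub_sigma_algebra; case: (HU x).
  apply: (@le_lt_trans _ _ (\sum_(x <- finmap.enum_fset D) mu (U x))%E).
    apply: (@le_trans _ _ (mu (\big[setU/set0]_(x <- finmap.enum_fset D) U x))).
      apply: le_measure; rewrite ?inE//; first exact: bigsetU_measurable.
      by move=> x /KD[y yD Uy]; rewrite -bigcup_seq; exists y.
    elim: (finmap.enum_fset D) => [|x s IH]; first by rewrite !big_nil measure0.
    rewrite !big_cons (le_trans (measureU2 _ _ _))//; first exact: bigsetU_measurable.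
    by rewrite leeD2l.
  by rewrite lte_sum_pinfty// => x _; case: (HU x).
have [c c0 muKc] : exists2 c : R, 0 <= c & mu K = c%:E.
  exists (fine (mu K)); first by rewrite fine_ge0.
  by rewrite fineK// ge0_fin_numE.
have bound (b : B) s : S s -> (L b : R) <= c * rho (val b + s).
  move=> Ss; rewrite -lee_fin -(muL b).2 mulrC EFinM -muKc -(integral_cst mu mK).
  rewrite (negligible_integral mCK measurableT (muL b).1 muCK).
  rewrite setTD setCK; apply: le_integral => //.
  - exact: integrableS (muL b).1.
  - apply: measurable_bounded_integrable => //; exact: bounded_cst.
  - move=> x /set_mem[]; rewrite gelfand_spectrum_le// => xle xS.
    rewrite lee_fin (le_trans _ (le_trans (ler_norm _) (xle _)))//.
    by rewrite gelfandD lerDl xS.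
exists (c + 1); first by rewrite ltr_wpDl.
move=> b; have c1 : 0 < c + 1 by rewrite ltr_wpDl.
rewrite mulrC -ler_pdivrMr//; apply: lb_le_inf.
  by exists (rho (val b + 1)), 1 => //; case: S_module.
move=> _ [s Ss <-]; rewrite ler_pdivrMr// mulrC (le_trans (bound b s Ss))//.
by rewrite ler_wpM2r ?(ssn_ge0 rho_seminorm)// lerDl.
Qed.

End Representation.

Theorem theorem2p2 (R : realType) (A : comAlgType R)
    (ne : [set: character A] !=set0)
    (rho : A -> R) (rho_seminorm : submultiplicative_seminorm rho)
    (P : pred A) (B : subLmodType P)
    (d : nat) (d_gt0 : (0 < d)%N)
    (S : set A) (S_module : power_module d S)
    (L : {linear B -> R^o}) :
  (exists mu : {measure set (borel_charspace ne) -> \bar R},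
     [/\ radon mu,
         support_contained mu (gelfand_spectrum rho `&` nonneg_characters S) &
         forall b : B,
           mu.-integrable [set: borel_charspace ne]
             (fun alpha => (gelfand (val b) alpha)%:E) /\
           (\int[mu]_alpha (gelfand (val b) alpha)%:E)%E = (L b)%:E]) <->
  (exists2 D : R, 0 < D &
     forall b : B, (L b : R) <= D * cone_seminorm S rho (val b)).
Proof.
split=> [[mu [mu_radon mu_supp muL]]|[D D0 LD]].
- exact: (representing_measure_bound rho_seminorm S_module mu_radon mu_supp muL).
- exact: (representing_measure_exists ne rho_seminorm d_gt0 S_module D0 LD).
Qed.
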